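(* For all $n,t\in\mathbb{N}$, $$0\le \mathrm{gap}(n)-\mathrm{gap}_2(n)\le 2\qquad\text{and}\qquad 0\le s_2(t)-s(t)\le 10.$$
   Context: All graphs are finite, simple and undirected. $\alpha(G)$ denotes the maximum size of a stable set, $\theta(G)$ the minimum number of cliques partitioning $V(G)$, and $\mathrm{gap}(G)=\theta(G)-\alpha(G)$. $\mathrm{gap}(n)$ (resp. $\mathrm{gap}_2(n)$) is the maximum of $\mathrm{gap}(G)$ over all graphs (resp. all triangle-free graphs) $G$ on $n$ vertices. $s(t)$ (resp. $s_2(t)$) is the smallest number of vertices of a graph (resp. a triangle-free graph) $G$ with $\mathrm{gap}(G)=t$. *)

(* Defs.v *)
From HB Require Import structures.
From mathcomp Require Import all_boot all_order all_algebra.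

Set Implicit Arguments.
Unset Strict Implicit.
Unset Printing Implicit Defensive.

(* The adjacency relation is stored as a finite function so that the graphs on
   a given finite vertex type form a finType. *)
Record sgraph (T : finType) := SGraph {
  adjf : {ffun T * T -> bool};
  _ : [forall x, ~~ adjf (x, x)] &&
      [forall x, forall y, adjf (x, y) == adjf (y, x)]
}.

HB.instance Definition _ (T : finType) := [isSub for @adjf T].
HB.instance Definition _ (T : finType) := [Finite of sgraph T by <:].

Definition adj (T : finType) (G : sgraph T) : rel T :=
  fun x y => adjf G (x, y).

Definition stable (T : finType) (G : sgraph T) (S : {set T}) : bool :=
  [forall x in S, forall y in S, ~~ adj G x y].

Definition clique (T : finType) (G : sgraph T) (K : {set T}) : bool :=
  [forall x in K, forall y in K, (x != y) ==> adj G x y].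

Definition triangle_free (T : finType) (G : sgraph T) : bool :=
  [forall x, forall y, forall z, ~~ [&& adj G x y, adj G y z & adj G x z]].

Definition alpha (T : finType) (G : sgraph T) : nat :=
  \max_(S : {set T} | stable G S) #|S|.

Definition clique_partition (T : finType) (G : sgraph T) (P : {set {set T}}) :=
  partition P [set: T] && [forall K in P, clique G K].

Lemma clique_partition_exists (T : finType) (G : sgraph T) :
  exists k, [exists P, clique_partition G P && (#|P| == k)].
Proof.
exists #|preim_partition (@id T) [set: T]|; apply/existsP.
exists (preim_partition (@id T) [set: T]); rewrite eqxx andbT.
rewrite /clique_partition preim_partitionP /=.
apply/forall_inP => _ /imsetP[x _ ->].
apply/forall_inP => y; rewrite !inE /= => /eqP <-.
by apply/forall_inP => z; rewrite !inE /= => ->.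
Qed.

Definition theta (T : finType) (G : sgraph T) : nat :=
  ex_minn (clique_partition_exists G).

(* This subtraction on nat never truncates: see alpha_le_theta. *)
Definition gap (T : finType) (G : sgraph T) : nat := theta G - alpha G.

(* Labelling the vertices by 'I_n loses no graph, since gap is invariant under
   isomorphism (gap_iso). *)
Definition gap_max (n : nat) : nat := \max_(G : sgraph 'I_n) gap G.

Definition gap_max2 (n : nat) : nat :=
  \max_(G : sgraph 'I_n | triangle_free G) gap G.

Section Facts.

Variables (T : finType) (G : sgraph T).

Lemma adj_irr x : adj G x x = false.
Proof.
by rewrite /adj; case: G => f /= /andP[/forallP/(_ x) /negbTE].
Qed.

Lemma adj_sym x y : adj G x y = adj G y x.
Proof.
by rewrite /adj; case: G => f /= /andP[_ /forallP/(_ x) /forallP/(_ y) /eqP].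
Qed.

Lemma stableP (S : {set T}) :
  reflect {in S &, forall x y, ~~ adj G x y} (stable G S).
Proof.
apply: (iffP forall_inP) => [H x y xS yS|H x xS].
  by have /forall_inP := H x xS; apply.
by apply/forall_inP => y yS; apply: H.
Qed.

Lemma cliqueP (K : {set T}) :
  reflect {in K &, forall x y, x != y -> adj G x y} (clique G K).
Proof.
apply: (iffP forall_inP) => [H x y xS yS|H x xS].
  by have /forall_inP/(_ y yS)/implyP := H x xS; apply.
by apply/forall_inP => y yS; apply/implyP/H.
Qed.

Lemma stable_le_alpha S : stable G S -> #|S| <= alpha G.
Proof. by move=> sS; rewrite /alpha (bigmax_sup S). Qed.

Lemma alpha_attained : exists2 S, stable G S & #|S| = alpha G.
Proof.
have s0 : stable G set0 by apply/stableP => x y; rewrite inE.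
by have [S sS eS] := @eq_bigmax_cond _ (stable G) (fun S => #|S|)
  (ltac:(apply/card_gt0P; exists set0; exact: s0)); exists S.
Qed.

Lemma theta_le P : clique_partition G P -> theta G <= #|P|.
Proof.
move=> cP; rewrite /theta; case: ex_minnP => m _; apply.
by apply/existsP; exists P; rewrite cP /=.
Qed.

Lemma theta_attained : exists2 P, clique_partition G P & #|P| = theta G.
Proof.
rewrite /theta; case: ex_minnP => m /existsP[P /andP[cP /eqP Pm]] _.
by exists P.
Qed.

Lemma alpha_le_theta : alpha G <= theta G.
Proof.
have [S /stableP sS <-] := alpha_attained.
have [P /andP[pP /forall_inP kP] <-] := theta_attained.
have inP_ x : x \in cover P by rewrite (cover_partition pP) inE.
rewrite -(@card_in_imset _ _ (pblock P) S) => [|x y xS yS eq_xy].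
  by apply/subset_leq_card/subsetP => _ /imsetP[x _ ->]; apply: pblock_mem.
apply/eqP/negPn/negP => nxy; have /negP := sS x y xS yS; apply.
have /cliqueP := kP _ (pblock_mem (inP_ x)); apply=> //.
  by rewrite mem_pblock.
by rewrite eq_xy mem_pblock.
Qed.

End Facts.

Lemma alpha_iso_le (T U : finType) (G : sgraph T) (H : sgraph U) (h : T -> U) :
  injective h -> {mono h : x y / adj G x y >-> adj H x y} -> alpha G <= alpha H.
Proof.
move=> injh hadj; have [S /stableP sS <-] := alpha_attained G.
rewrite -(card_imset _ injh); apply: stable_le_alpha; apply/stableP.
by move=> _ _ /imsetP[x xS ->] /imsetP[y yS ->]; rewrite hadj; apply: sS.
Qed.

Lemma theta_iso_le (T U : finType) (G : sgraph T) (H : sgraph U) (h : T -> U) :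
  bijective h -> {mono h : x y / adj G x y >-> adj H x y} -> theta H <= theta G.
Proof.
move=> bijh hadj; have injh := bij_inj bijh.
have [P /andP[pP /forall_inP kP] <-] := theta_attained G.
rewrite -(card_imset _ (imset_inj injh)); apply: theta_le; apply/andP; split.
  have <- : h @: [set: T] = [set: U].
    apply/setP => u; rewrite inE; case: bijh => k _ hk.
    by rewrite -(hk u) imset_f.
  by rewrite imset_partition.
apply/forall_inP => _ /imsetP[K KP ->]; apply/cliqueP.
move=> _ _ /imsetP[x xK ->] /imsetP[y yK ->]; rewrite hadj inj_eq // => nxy.
by have /cliqueP := kP K KP; apply.
Qed.

Lemma gap_iso (T U : finType) (G : sgraph T) (H : sgraph U) (h : T -> U) :
  bijective h -> {mono h : x y / adj G x y >-> adj H x y} -> gap G = gap H.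
Proof.
move=> bijh hadj; case: (bijh) => k hk kh.
have bijk : bijective k by exists h.
have kadj : {mono k : x y / adj H x y >-> adj G x y}.
  by move=> x y; rewrite -hadj !kh.
rewrite /gap; congr (_ - _); apply/eqP; rewrite eqn_leq.
  by rewrite (theta_iso_le bijh hadj) (theta_iso_le bijk kadj).
by rewrite (alpha_iso_le (bij_inj bijh) hadj) (alpha_iso_le (bij_inj bijk) kadj).
Qed.

(* The disjoint union of t five-cycles is triangle-free, has alpha = 2t and
   theta = 3t, and hence gap t: every t is the gap of some (triangle-free)
   graph, so that smin and smin2 below are total. *)
Section FiveCycles.

Variable t : nat.
Let V := ('I_t * 'I_5)%type.

Definition c5 : rel 'I_5 :=
  fun i j => (i.+1 %% 5 == j :> nat) || (j.+1 %% 5 == i :> nat).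

Definition fc_adjf : {ffun V * V -> bool} :=
  [ffun p => (p.1.1 == p.2.1) && c5 p.1.2 p.2.2].

Lemma fc_proof : [forall x, ~~ fc_adjf (x, x)] &&
  [forall x, forall y, fc_adjf (x, y) == fc_adjf (y, x)].
Proof.
apply/andP; split; apply/forallP => x.
  by rewrite ffunE /= eqxx /=; case: (x.2) => -[|[|[|[|[|?]]]]].
by apply/forallP => y; rewrite !ffunE /= (eq_sym x.1) {1}/c5 orbC.
Qed.

Definition fc : sgraph V := SGraph fc_proof.

Lemma fc_adjE x y : adj fc x y = (x.1 == y.1) && c5 x.2 y.2.
Proof. by rewrite /adj ffunE. Qed.

Lemma c5_triangle i j k : ~~ [&& c5 i j, c5 j k & c5 i k].
Proof.
by case: i => -[|[|[|[|[|?]]]]] // ?; case: j => -[|[|[|[|[|?]]]]] // ?;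
   case: k => -[|[|[|[|[|?]]]]].
Qed.

Lemma fc_triangle_free : triangle_free fc.
Proof.
apply/forallP => x; apply/forallP => y; apply/forallP => z.
apply: contra (c5_triangle x.2 y.2 z.2); rewrite !fc_adjE.
by case/and3P => /andP[_ ->] /andP[_ ->] /andP[_ ->].
Qed.

Definition slice (S : {set V}) (i : 'I_t) : {set 'I_5} :=
  [set j | (i, j) \in S].

Lemma card_slices (S : {set V}) : #|S| = \sum_i #|slice S i|.
Proof.
transitivity (\sum_(i : 'I_t) \sum_(j : 'I_5 | (i, j) \in S) 1).
  rewrite pair_big_dep /= sum1_card; by apply: eq_card => -[i j].
apply: eq_bigr => i _; rewrite sum1_card.
by apply: eq_card => j; rewrite !inE.
Qed.

Lemma card_I5 (A : {set 'I_5}) : #|A| =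
  (inord 0 \in A) + (inord 1 \in A) + (inord 2 \in A) + (inord 3 \in A)
  + (inord 4 \in A).
Proof.
rewrite -sum1_card big_mkcond /= !big_ord_recl big_ord0 addn0 !addnA.
have e (k : nat) (i : 'I_5) : i = k :> nat -> (if i \in A then 1 else 0) = (inord k \in A).
  by move=> <-; rewrite inord_val; case: ifP.
by congr (_ + _ + _ + _ + _); apply: e.
Qed.

Lemma c5_stable (A : {set 'I_5}) :
  {in A &, forall i j, ~~ c5 i j} -> #|A| <= 2.
Proof.
move=> sA; rewrite card_I5.
have n k l : inord k \in A -> inord l \in A -> ~~ c5 (inord k) (inord l).
  exact: sA.
move: (n 0 1) (n 1 2) (n 2 3) (n 3 4) (n 4 0); rewrite /c5 !inordK //=.
by do 5![case: (_ \in A)] => //= h1 h2 h3 h4 h5;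
  (try by have := h1 isT isT); (try by have := h2 isT isT);
  (try by have := h3 isT isT); (try by have := h4 isT isT);
  (try by have := h5 isT isT).
Qed.

Lemma c5_clique (A : {set 'I_5}) :
  {in A &, forall i j, i != j -> c5 i j} -> #|A| <= 2.
Proof.
move=> sA; rewrite card_I5.
have n k l : k < 5 -> l < 5 -> k != l ->
    inord k \in A -> inord l \in A -> c5 (inord k) (inord l).
  by move=> k5 l5 kl kA lA; apply: sA => //; rewrite -val_eqE /= !inordK.
move: (n 0 2 isT isT isT) (n 1 3 isT isT isT) (n 2 4 isT isT isT)
      (n 3 0 isT isT isT) (n 4 1 isT isT isT); rewrite /c5 !inordK //=.
by do 5![case: (_ \in A)] => //= h1 h2 h3 h4 h5;
  (try by have := h1 isT isT); (try by have := h2 isT isT);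
  (try by have := h3 isT isT); (try by have := h4 isT isT);
  (try by have := h5 isT isT).
Qed.

Lemma fc_alpha : alpha fc = t * 2.
Proof.
apply/eqP; rewrite eqn_leq; apply/andP; split.
  have [S /stableP sS <-] := alpha_attained fc.
  rewrite card_slices -[t in t * 2](card_ord t) -sum_nat_const.
  apply: leq_sum => i _; apply: c5_stable => j k; rewrite !inE => jS kS.
  by have := sS _ _ jS kS; rewrite fc_adjE eqxx.
pose A : {set 'I_5} := [set j : 'I_5 | (j == 0 :> nat) || (j == 2 :> nat)].
have <- : #|setX [set: 'I_t] A| = t * 2.
  rewrite cardsX cardsT card_ord; congr (_ * _).
  by rewrite card_I5 !inE !inordK.
apply: stable_le_alpha; apply/stableP => -[a i] [b j].
rewrite !inE fc_adjE /= => iA jA; rewrite negb_and; apply/orP; right.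
by rewrite /c5; case/orP: iA => /eqP ->; case/orP: jA => /eqP ->.
Qed.

Lemma fc_theta : theta fc = t * 3.
Proof.
apply/eqP; rewrite eqn_leq; apply/andP; split.
  pose f (x : V) : 'I_t * 'I_3 := (x.1, inord (x.2)./2).
  have fE x y : f x = f y -> x.1 = y.1 /\ (x.2)./2 = (y.2)./2.
    case: x y => a i [b j] [-> /(congr1 val) /=]; rewrite !inordK //.
      by case: j => -[|[|[|[|[|?]]]]].
    by case: i => -[|[|[|[|[|?]]]]].
  pose P := preim_partition f [set: V].
  apply: (@leq_trans #|P|).
    apply: theta_le; rewrite /clique_partition preim_partitionP /=.
    apply/forall_inP => _ /imsetP[x _ ->]; apply/cliqueP => y z.
    rewrite !inE => /eqP/fE[a1 a2] /eqP/fE[b1 b2] nyz.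
    have eqyz : y.1 = z.1 by rewrite -a1.
    rewrite fc_adjE eqyz eqxx /=.
    have : y.2 != z.2 by apply: contra nyz => /eqP e2; case: (y) (z) eqyz e2 => ? ? [? ?] /= -> ->.
    move: b2; rewrite a2 -val_eqE /c5.
    by case: (y.2) => -[|[|[|[|[|?]]]]] // ?; case: (z.2) => -[|[|[|[|[|?]]]]].
  have sP : P \subset [set [set y | k == f y] | k in [set: 'I_t * 'I_3]].
    apply/subsetP => _ /imsetP[x _ ->]; apply/imsetP; exists (f x) => //.
    by apply/setP => y; rewrite !inE.
  apply: (leq_trans (subset_leq_card sP)); apply: (leq_trans (leq_imset_card _ _)).
  by rewrite cardsT card_prod !card_ord.
have [P /andP[pP /forall_inP kP] <-] := theta_attained fc.
pose B i := [set K in P | slice K i != set0].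
have kfst K x y : K \in P -> x \in K -> y \in K -> x.1 = y.1.
  move=> KP xK yK; have [->//|nxy] := eqVneq x y.
  have /cliqueP/(_ x y xK yK nxy) := kP K KP.
  by rewrite fc_adjE => /andP[/eqP].
have cB i : 3 <= #|B i|.
  rewrite -(ltn_pmul2r (isT : 0 < 2)).
  apply: (@leq_trans #|\bigcup_(K in B i) slice K i|).
    rewrite (_ : \bigcup_(K in B i) _ = setT) ?cardsT ?card_ord //.
    apply/setP => j; rewrite inE; apply/bigcupP.
    have cij : (i, j) \in cover P by rewrite (cover_partition pP) inE.
    have ij : j \in slice (pblock P (i, j)) i by rewrite inE mem_pblock.
    exists (pblock P (i, j)) => //.
    by rewrite inE pblock_mem //=; apply/set0Pn; exists j.
  apply: (@leq_trans (\sum_(K in B i) #|slice K i|)).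
    elim/big_rec2: _ => [|K n A _ IH]; first by rewrite cards0.
    by rewrite (leq_trans (leq_card_setU _ _)) // leq_add2l.
  rewrite -sum_nat_const; apply: leq_sum => K; rewrite inE => /andP[KP _].
  apply: c5_clique => j k; rewrite !inE => jK kK njk.
  have /cliqueP/(_ _ _ jK kK) := kP K KP; rewrite fc_adjE eqxx /=; apply.
  by apply: contra njk => /eqP[->].
apply: (@leq_trans (\sum_(i < t) #|B i|)).
  rewrite -[in t * 3](card_ord t) -sum_nat_const.
  by apply: leq_sum => i _; apply: cB.
under eq_bigr do rewrite -sum1_card big_mkcond /=.
rewrite exchange_big /= -sum1_card [leqRHS]big_mkcond /=.
apply: leq_sum => K _; case: ifP => KP; last first.
  by rewrite big1 // => i _; rewrite inE KP.
have [x xK] := set0Pn _ (partition_neq0 pP KP).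
rewrite (bigD1 x.1) //= big1 ?addn0 => [|i nix]; first by case: ifP.
case: ifP => //; rewrite inE => /andP[_ /set0Pn[j]]; rewrite inE => ijK.
by rewrite -(kfst K _ x KP ijK xK) eqxx in nix.
Qed.

Lemma fc_gap : gap fc = t.
Proof. by rewrite /gap fc_theta fc_alpha -mulnBr muln1. Qed.

End FiveCycles.

Lemma relabel_proof (T : finType) (G : sgraph T) (n : nat) (h : 'I_n -> T) :
  let f := [ffun p : 'I_n * 'I_n => adj G (h p.1) (h p.2)] in
  [forall x, ~~ f (x, x)] && [forall x, forall y, f (x, y) == f (y, x)].
Proof.
apply/andP; split; apply/forallP => x; first by rewrite ffunE adj_irr.
by apply/forallP => y; rewrite !ffunE adj_sym.
Qed.

Lemma gap2_attained (t : nat) :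
  exists n, [exists G : sgraph 'I_n, triangle_free G && (gap G == t)].
Proof.
exists #|{: 'I_t * 'I_5}|; apply/existsP.
pose G := SGraph (relabel_proof (fc t) (@enum_val _ {: 'I_t * 'I_5})).
have adjG i j : adj (fc t) (enum_val i) (enum_val j) = adj G i j.
  by rewrite {2}/adj ffunE.
exists G; apply/andP; split.
  apply/forallP => x; apply/forallP => y; apply/forallP => z.
  rewrite -!adjG; have /forallP/(_ (enum_val x)) := fc_triangle_free t.
  by move/forallP/(_ (enum_val y))/forallP/(_ (enum_val z)).
rewrite -[X in _ == X]fc_gap; apply/eqP.
by apply: gap_iso (@enum_val_bij _) _ => x y; rewrite adjG.
Qed.

Lemma gap_attained (t : nat) :
  exists n, [exists G : sgraph 'I_n, gap G == t].
Proof.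
have [n /existsP[G /andP[_ gG]]] := gap2_attained t.
by exists n; apply/existsP; exists G.
Qed.

Definition smin (t : nat) : nat := ex_minn (gap_attained t).

Definition smin2 (t : nat) : nat := ex_minn (gap2_attained t).

(* Main.v *)
(* A bound gap(n) <= gap_2(n) + 2 suffices: adding two disjoint 5-cycles raises
   the gap by 2, and deleting a vertex lowers it by at most 1.

   Let G have n vertices, and remove k disjoint triangles from G so as to leave
   a triangle-free graph H; then gap(G) <= gap(H) + k. One has to find a
   triangle-free graph with 3k more vertices than H whose gap is at least
   gap(H) + k - 2. Triangle-free graphs satisfy theta >= n / 2, so that it
   suffices to build graphs of small stability number. These are obtained from
   twelve circulant graphs by gluing: from triangle-free graphs with orders
   n1, n2 and stability numbers a1, a2 one gets a triangle-free graph of order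
   n1 + n2 + min(a1, a2) and stability number at most a1 + a2. In particular
   gap_2(n) >= (n - 8) / 3 for all n, which settles the case gap(H) = 0.

   Otherwise delete vertices from H until theta decreases with every further
   deletion. By Gallai's lemma the components C of H then satisfy
   2 theta(C) = |C| + 1. Either |C| >= 3 gap(C) + 2, and the bound on gap_2
   applies to |C| + 3k vertices, or C has stability number at least 8, and a
   suitable graph is obtained by gluing to C. *)
Require Import Defs.
From mathcomp Require Import all_boot all_order all_algebra.
From mathcomp Require Import zify.

Set Implicit Arguments.
Unset Strict Implicit.
Unset Printing Implicit Defensive.

(** * Clique colorings, induced subgraphs, disjoint unions *)

(** Clique partitions are handled as maps whose fibres are cliques: an upper bound on [theta] then
    only requires a map into a small type, and empty fibres do no harm. *)
Definition clique_coloring (T C : finType) (G : sgraph T) (f : T -> C) :=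
  forall x y, f x = f y -> x != y -> adj G x y.

Lemma theta_le_imset (T C : finType) (G : sgraph T) (f : T -> C) :
  clique_coloring G f -> theta G <= #|f @: [set: T]|.
Proof.
move=> fG; pose P := preim_partition f [set: T].
apply: (@leq_trans #|P|).
  apply: theta_le; rewrite /clique_partition preim_partitionP /=.
  apply/forall_inP => _ /imsetP[x _ ->]; apply/cliqueP => y z.
  by rewrite !inE => /eqP fy /eqP fz; apply: fG; rewrite -fy.
have sP : P \subset [set [set y | c == f y] | c in f @: [set: T]].
  apply/subsetP => _ /imsetP[x _ ->]; apply/imsetP; exists (f x).
    exact: imset_f.
  by apply/setP => y; rewrite !inE.
exact: leq_trans (subset_leq_card sP) (leq_imset_card _ _).
Qed.

Lemma theta_le_card (T C : finType) (G : sgraph T) (f : T -> C) :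
  clique_coloring G f -> theta G <= #|C|.
Proof. by move=> /theta_le_imset h; apply: leq_trans h (max_card _). Qed.

Lemma theta_coloring (T : finType) (G : sgraph T) :
  exists (C : finType) (f : T -> C), #|C| = theta G /\ clique_coloring G f.
Proof.
have [P /andP[pP /forall_inP kP] <-] := theta_attained G.
have cP x : x \in cover P by rewrite (cover_partition pP) inE.
exists {K : {set T} | K \in P}.
exists (fun x => exist _ (pblock P x) (pblock_mem (cP x))); split.
  by rewrite card_sig; apply: eq_card => K.
move=> x y [exy] nxy; have /cliqueP := kP _ (pblock_mem (cP x)); apply=> //.
  by rewrite mem_pblock.
by rewrite exy mem_pblock.
Qed.

Lemma alpha_leP (T : finType) (G : sgraph T) (k : nat) :
  (forall S, stable G S -> #|S| <= k) -> alpha G <= k.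
Proof. by move=> h; apply/bigmax_leqP => S; apply: h. Qed.

Lemma graph_of_proof (T : finType) (e : rel T) :
  let f := [ffun p : T * T => (p.1 != p.2) && (e p.1 p.2 || e p.2 p.1)] in
  [forall x, ~~ f (x, x)] && [forall x, forall y, f (x, y) == f (y, x)].
Proof.
apply/andP; split; apply/forallP => x; first by rewrite ffunE /= eqxx.
by apply/forallP => y; rewrite !ffunE /= (eq_sym x) (orbC (e x y)).
Qed.

(** Symmetrizing and removing loops turns any relation into a graph without a proof obligation. *)
Definition graph_of (T : finType) (e : rel T) : sgraph T :=
  SGraph (graph_of_proof e).

Lemma adj_graph_of (T : finType) (e : rel T) x y :
  adj (graph_of e) x y = (x != y) && (e x y || e y x).
Proof. by rewrite /adj ffunE. Qed.

Lemma triangle_freeP (T : finType) (G : sgraph T) :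
  reflect (forall x y z, adj G x y -> adj G y z -> ~~ adj G x z)
          (triangle_free G).
Proof.
apply: (iffP forallP) => [h x y z xy yz|h x].
  by have /forallP/(_ y)/forallP/(_ z) := h x; rewrite xy yz.
apply/forallP => y; apply/forallP => z; apply/and3P => -[xy yz].
by apply/negP; apply: h xy yz.
Qed.

(** Serves for induced subgraphs when [h] is injective and for relabelling when it is bijective. *)
Definition pull (U T : finType) (h : U -> T) (G : sgraph T) : sgraph U :=
  graph_of (fun x y => adj G (h x) (h y)).

Lemma adj_pull (U T : finType) (h : U -> T) (G : sgraph T) x y :
  adj (pull h G) x y = adj G (h x) (h y).
Proof.
rewrite adj_graph_of (adj_sym G (h y)) orbb.
by case: eqP => // ->; rewrite adj_irr.
Qed.

Section Pull.

Variables (U T : finType) (h : U -> T) (G : sgraph T).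

Lemma pull_triangle_free : triangle_free G -> triangle_free (pull h G).
Proof.
by move/triangle_freeP => tG; apply/triangle_freeP => x y z; rewrite !adj_pull;
   apply: tG.
Qed.

Hypothesis injh : injective h.

Lemma alpha_pull : alpha (pull h G) <= alpha G.
Proof. by apply: (alpha_iso_le injh) => x y; rewrite adj_pull. Qed.

End Pull.

Lemma theta_split (T U1 U2 : finType) (G : sgraph T)
    (h1 : U1 -> T) (h2 : U2 -> T) (s : T -> U1 + U2) :
  (forall x, match s x with inl u => h1 u | inr u => h2 u end = x) ->
  theta G <= theta (pull h1 G) + theta (pull h2 G).
Proof.
move=> hs; have [C1 [f1 [<- f1G]]] := theta_coloring (pull h1 G).
have [C2 [f2 [<- f2G]]] := theta_coloring (pull h2 G).
rewrite -card_sum.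
apply: (@theta_le_card _ _ _ (fun x => match s x with
  inl u => inl (f1 u) | inr u => inr (f2 u) end)) => x y.
have := hs x; have := hs y; case: (s x) (s y) => [u|u] [v|v] // <- <- [fuv] nuv.
  by rewrite -adj_pull; apply: f1G fuv _; apply: contra nuv => /eqP->.
by rewrite -adj_pull; apply: f2G fuv _; apply: contra nuv => /eqP->.
Qed.

Definition restrict (T : finType) (G : sgraph T) (X : {set T}) :
  sgraph {x | x \in X} := pull val G.

Section Restrict.

Variables (T : finType) (G : sgraph T).
Implicit Types X : {set T}.

Lemma card_restrict X : #|{: {x | x \in X}}| = #|X|.
Proof. by rewrite card_sig; apply: eq_card => x. Qed.

Lemma restrict_triangle_free X : triangle_free G -> triangle_free (restrict G
  X).
Proof. exact: pull_triangle_free. Qed.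

Lemma alpha_restrict X : alpha (restrict G X) <= alpha G.
Proof. exact: alpha_pull val_inj. Qed.

Lemma theta_restrictC X :
  theta G <= theta (restrict G X) + theta (restrict G (~: X)).
Proof.
have inC x : x \notin X -> x \in ~: X by rewrite inE.
apply: (@theta_split _ _ _ _ _ _ (fun x => match boolP (x \in X) with
  | AltTrue p => inl (exist _ x p)
  | AltFalse p => inr (exist _ x (inC _ p)) end)) => x.
by case: {-}_ / boolP.
Qed.

Lemma theta_clique X : clique G X -> theta (restrict G X) <= 1.
Proof.
move/cliqueP => cX; rewrite -card_unit.
apply: (@theta_le_card _ _ _ (fun=> tt)) => x y _ nxy; rewrite adj_pull.
by apply: cX; [exact: valP|exact: valP|].
Qed.

End Restrict.

Lemma theta_le_order (T : finType) (G : sgraph T) : theta G <= #|T|.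
Proof. by apply: (@theta_le_card _ _ _ id) => x y ->; rewrite eqxx. Qed.

(* Fibres of a clique coloring have at most two vertices. *)
Lemma card_le_theta2 (T : finType) (G : sgraph T) :
  triangle_free G -> #|T| <= (theta G).*2.
Proof.
move/triangle_freeP => tG; have [C [f [<- fG]]] := theta_coloring G.
rewrite -muln2 -sum_nat_const -sum1_card (partition_big f predT) //=.
apply: leq_sum => c _; rewrite sum1_card; rewrite leqNgt; apply/negP.
case/card_gt2P => x [y [z [[]]]]; rewrite !unfold_in /= => /eqP fx /eqP fy
  /eqP fz [xy yz zx].
have axy := fG x y (etrans fx (esym fy)) xy.
have ayz := fG y z (etrans fy (esym fz)) yz.
have := tG _ _ _ axy ayz; rewrite (fG x z) ?fx ?fz //.
by rewrite eq_sym.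
Qed.

Definition dunion_rel (T U : finType) (G : sgraph T) (H : sgraph U) : rel (T
  + U) :=
  fun x y => match x, y with
  | inl a, inl b => adj G a b
  | inr a, inr b => adj H a b
  | _, _ => false
  end.

Definition dunion (T U : finType) (G : sgraph T) (H : sgraph U) :
  sgraph (T + U)%type := graph_of (dunion_rel G H).

Section DisjointUnion.

Variables (T U : finType) (G : sgraph T) (H : sgraph U).

Lemma adj_dunion x y : adj (dunion G H) x y = dunion_rel G H x y.
Proof.
rewrite adj_graph_of; case: x y => [x|x] [y|y] //=; rewrite ?andbF //.
  by rewrite (adj_sym G y) orbb; case: eqP => // -[->]; rewrite adj_irr.
by rewrite (adj_sym H y) orbb; case: eqP => // -[->]; rewrite adj_irr.
Qed.

Lemma dunion_triangle_free :
  triangle_free G -> triangle_free H -> triangle_free (dunion G H).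
Proof.
move=> /triangle_freeP tG /triangle_freeP tH; apply/triangle_freeP.
by move=> [x|x] [y|y] [z|z]; rewrite !adj_dunion //=; [apply: tG|apply: tH].
Qed.

Lemma card_sum_set (S : {set (T + U)%type}) :
  #|S| = #|inl @^-1: S| + #|inr @^-1: S|.
Proof.
rewrite -(card_imset _ (@inl_inj T U)) -(card_imset _ (@inr_inj T U)).
rewrite -cardsUI (_ : _ :&: _ = set0) ?cards0 ?addn0.
  apply: eq_card => -[x|x]; rewrite !inE.
    rewrite mem_imset ?inE; last exact: inl_inj.
    by rewrite [X in _ || X](_ : _ = false) ?orbF //; apply/imsetP => -[].
  rewrite orbC mem_imset ?inE; last exact: inr_inj.
  by rewrite [X in _ || X](_ : _ = false) ?orbF //; apply/imsetP => -[].
by apply/setP => x; rewrite !inE; apply/andP => -[/imsetP[y _ ->]] /imsetP[].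
Qed.

Lemma alpha_dunion : alpha (dunion G H) <= alpha G + alpha H.
Proof.
apply: alpha_leP => S /stableP sS; rewrite card_sum_set.
by apply: leq_add; apply: stable_le_alpha; apply/stableP => x y;
   rewrite !inE => xS yS; have := sS _ _ xS yS; rewrite adj_dunion.
Qed.

Lemma alpha_dunion_ge : alpha G + alpha H <= alpha (dunion G H).
Proof.
have [S /stableP sS <-] := alpha_attained G.
have [R /stableP sR <-] := alpha_attained H.
pose Q : {set (T + U)%type} :=
  [set x | match x with inl a => a \in S | inr a => a \in R end].
have -> : #|S| + #|R| = #|Q|.
  rewrite card_sum_set.
  by congr (_ + _); apply: eq_card => x; rewrite !inE.
apply: stable_le_alpha; apply/stableP => -[x|x] [y|y];
  rewrite !inE adj_dunion //=.
  exact: sS.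
exact: sR.
Qed.

(** No clique meets both sides, so a clique coloring uses disjoint sets of colours on them. *)
Lemma theta_dunion : theta G + theta H <= theta (dunion G H).
Proof.
have [C [f [<- fGH]]] := theta_coloring (dunion G H).
have := @theta_le_imset _ _ G (f \o inl);
  have := @theta_le_imset _ _ H (f \o inr).
set B := imset _ _; set A := imset _ _ => hB hA.
apply: (@leq_trans (#|A| + #|B|)).
  by apply: leq_add; [apply: hA|apply: hB] => x y /= fxy nxy;
    (have := fGH _ _ fxy; rewrite adj_dunion; apply);
    apply: contra nxy => /eqP[->].
rewrite -cardsUI (_ : A :&: B = set0) ?cards0 ?addn0 ?max_card //.
apply/setP => c; rewrite !inE; apply/andP => -[/imsetP[x _ ->] /imsetP[y _
  fxy]].
by have := fGH _ _ fxy isT; rewrite adj_dunion.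
Qed.

Lemma gap_dunion : gap G + gap H <= gap (dunion G H).
Proof.
have := theta_dunion; have := alpha_dunion.
have := alpha_le_theta G; have := alpha_le_theta H; rewrite /gap; lia.
Qed.

End DisjointUnion.

Definition edgeless (T : finType) : sgraph T := graph_of (fun _ _ => false).

Lemma adj_edgeless (T : finType) (x y : T) : adj (edgeless T) x y = false.
Proof. by rewrite adj_graph_of andbF. Qed.

Lemma edgeless_triangle_free (T : finType) : triangle_free (edgeless T).
Proof. by apply/triangle_freeP => x y z; rewrite adj_edgeless. Qed.

Lemma alpha_edgeless (T : finType) : alpha (edgeless T) = #|T|.
Proof.
apply/eqP; rewrite eqn_leq; apply/andP; split.
  by apply: alpha_leP => S _; apply: max_card.
rewrite -cardsT; apply: stable_le_alpha; apply/stableP => x y _ _.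
by rewrite adj_edgeless.
Qed.

(** Padding with isolated vertices up to order [n] does not lower the gap. *)
Lemma gap_le_gap_max2 (T : finType) (G : sgraph T) (n : nat) :
  triangle_free G -> #|T| <= n -> gap G <= gap_max2 n.
Proof.
move=> tG leTn; set H := dunion G (edgeless 'I_(n - #|T|)).
have cH : #|{: T + 'I_(n - #|T|)}| = n by rewrite card_sum card_ord subnKC.
pose h (i : 'I_n) : T + 'I_(n - #|T|) := enum_val (cast_ord (esym cH) i).
have bij_h : bijective h.
  by apply: bij_comp; [exact: enum_val_bij|exact: (Bijective (cast_ordK _)
    (cast_ordKV _))].
apply: (@leq_trans (gap (pull h H))).
  rewrite (gap_iso bij_h (H := H)) => [|x y]; last by rewrite adj_pull.
  exact: leq_trans (leq_addr _ _) (gap_dunion _ _).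
apply: (@bigmax_sup _ (pull h H)) => //; apply: pull_triangle_free.
by apply: dunion_triangle_free => //; apply: edgeless_triangle_free.
Qed.

(** * Gluing triangle-free graphs *)

Lemma adj_graph_of_sym (T : finType) (e : rel T) :
  irreflexive e -> symmetric e -> adj (graph_of e) =2 e.
Proof.
move=> ie se x y; rewrite adj_graph_of (se y) orbb.
by case: eqP => // ->; rewrite ie.
Qed.

Lemma exists_injection (T : finType) (A : {set T}) (k : nat) :
  k <= #|A| -> exists2 f : 'I_k -> T, injective f & forall i, f i \in A.
Proof.
move=> leA; exists (fun i => enum_val (widen_ord leA i)) => [i j|i].
  by move/enum_val_inj/(congr1 val) => /= ij; apply: val_inj.
exact: enum_valP.
Qed.

(** In terms of Ramsey numbers: R(3, a + 1) > n. *)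
Definition ramsey_graph (n a : nat) : Prop :=
  exists (T : finType) (G : sgraph T),
    [/\ triangle_free G, #|T| = n & alpha G <= a].

Lemma ramsey_graph_mono n m a b :
  m <= n -> a <= b -> ramsey_graph n a -> ramsey_graph m b.
Proof.
move=> lemn leab [T [G [tG cT aG]]].
have [|f injf _] := @exists_injection T setT m; first by rewrite cardsT cT.
exists 'I_m, (pull f G); split; first exact: pull_triangle_free.
  by rewrite card_ord.
exact: leq_trans (alpha_pull _ injf) (leq_trans aG leab).
Qed.

(* Trade vertices outside a maximum stable set for isolated ones. *)
Lemma ramsey_graph_exact n a : a <= n -> ramsey_graph n a ->
  exists (T : finType) (G : sgraph T),
    [/\ triangle_free G, #|T| = n & alpha G = a].
Proof.
move=> lean [T [G [tG cT aG]]]; have [S sS cS] := alpha_attained G.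
have [|f injf fS] := @exists_injection T (~: S) (a - alpha G).
  by rewrite cardsCs setCK cT cS leq_sub2r.
pose D := f @: [set: 'I_(a - alpha G)].
have cD : #|D| = a - alpha G by rewrite card_imset // cardsT card_ord.
exists ({x | x \in ~: D} + 'I_(a - alpha G))%type.
exists (dunion (restrict G (~: D)) (edgeless _)); split.
- by apply: dunion_triangle_free; [exact: restrict_triangle_free|exact:
  edgeless_triangle_free].
- by rewrite card_sum card_restrict card_ord cardsCs setCK cD cT subnK //
  (leq_trans (leq_subr _ _)).
have aD : alpha (restrict G (~: D)) = alpha G.
  apply/eqP; rewrite eqn_leq alpha_restrict /= -cS.
  pose R : {set {x | x \in ~: D}} := val @^-1: S.
  have <- : #|R| = #|S|.
    rewrite -(card_imset _ val_inj); apply: eq_card => x.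
    apply/imsetP/idP => [[y]|xS]; first by rewrite inE => yS ->.
    have xD : x \in ~: D.
      rewrite inE; apply/imsetP => -[i _ ex].
      by have := fS i; rewrite inE -ex xS.
    by exists (Sub x xD); rewrite ?inE SubK.
  apply: stable_le_alpha; apply/stableP => x y; rewrite !inE => xS yS.
  by rewrite adj_pull; move/stableP: sS; apply.
apply/eqP; rewrite eqn_leq; apply/andP; split.
  by apply: leq_trans (alpha_dunion _ _) _;
    rewrite aD alpha_edgeless card_ord subnKC.
by apply: leq_trans (alpha_dunion_ge _ _);
  rewrite aD alpha_edgeless card_ord subnKC.
Qed.

Section Gluing.

Variables (T U : finType) (G : sgraph T) (H : sgraph U) (s : nat).
Variables (v : 'I_s -> T) (u : 'I_s -> U).
Hypotheses (injv : injective v) (inju : injective u).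
Hypotheses (sv : forall i j, ~~ adj G (v i) (v j)).
Hypotheses (su : forall i j, ~~ adj H (u i) (u j)).

Let V := ((T + U) + 'I_s)%type.

Let cross x y := [exists i, (v i == x) && adj H (u i) y].

(** The new vertex [i] copies the neighbourhood of [v i] in [G] and is joined in [H] to [u i] alone;
    [v i] is joined in [H] to the neighbours of [u i]. *)
Definition glue_rel : rel V := fun p q => match p, q with
  | inl (inl x), inl (inl y) => adj G x y
  | inl (inr x), inl (inr y) => adj H x y
  | inl (inl x), inl (inr y) => cross x y
  | inl (inr y), inl (inl x) => cross x y
  | inr i, inl (inl x) => adj G (v i) x
  | inl (inl x), inr i => adj G (v i) x
  | inr i, inl (inr y) => u i == y
  | inl (inr y), inr i => u i == y
  | inr _, inr _ => false
  end.

Definition glue : sgraph V := graph_of glue_rel.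

Lemma adj_glue : adj glue =2 glue_rel.
Proof.
apply: adj_graph_of_sym => [[[x|x]|x]|[[x|x]|x] [[y|y]|y]] //=.
- exact: adj_irr.
- exact: adj_irr.
- exact: adj_sym.
- exact: adj_sym.
Qed.

(** The facts [n1] to [n6] cover the possible types of triangle. Stability of the [v i] excludes
    those containing a cross edge and an edge at a vertex of [G]; a triangle with one vertex [v i]
    and two in [H] would give one in [H] through [u i]; and a new vertex has a single neighbour in
    [H]. *)
Lemma glue_triangle_free :
  triangle_free G -> triangle_free H -> triangle_free glue.
Proof.
move=> /triangle_freeP tG /triangle_freeP tH.
have sG x y : adj G x y -> adj G y x by rewrite adj_sym.
have sH x y : adj H x y -> adj H y x by rewrite adj_sym.
have n1 x y z : adj G x y -> adj G y z -> adj G x z -> False.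
  by move=> h1 h2; apply/negP/(tG _ _ _ h1 h2).
have n2 x y z : adj H x y -> adj H y z -> adj H x z -> False.
  by move=> h1 h2; apply/negP/(tH _ _ _ h1 h2).
have n3 x y z : adj G x y -> cross x z -> cross y z -> False.
  move=> axy /existsP[i /andP[/eqP vi _]] /existsP[j /andP[/eqP vj _]].
  by move: axy; rewrite -vi -vj; apply/negP.
have n4 x y z : adj H y z -> cross x y -> cross x z -> False.
  move=> ayz /existsP[i /andP[/eqP vi ai]] /existsP[j /andP[/eqP vj aj]].
  move: aj; rewrite (injv (etrans vj (esym vi))).
  exact: n2 ai ayz.
have n5 x y i : cross x y -> adj G (v i) x -> False.
  by move=> /existsP[j /andP[/eqP <- _]]; apply/negP.
have n6 x y i : adj H x y -> u i == x -> u i == y -> False.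
  by move=> + /eqP ex /eqP ey; rewrite -ex -ey adj_irr.
apply/triangle_freeP => -[[x|x]|x] [[y|y]|y] [[z|z]|z];
  rewrite !adj_glue /= => // h1 h2; apply/negP => // h3; eauto 4.
Qed.

(** Each new vertex [i] of a stable set [S] is traded for [v i] if [v i] is not in [S], and for
    [u i] otherwise. The first trade is safe since [i] and [v i] have the same neighbours in [G];
    the second since [v i] in [S] keeps the neighbours of [u i] out of [S]. *)
Lemma alpha_glue : alpha glue <= alpha G + alpha H.
Proof.
apply: alpha_leP => S /stableP sS.
have nS p q : p \in S -> q \in S -> ~~ glue_rel p q.
  by move=> pS qS; rewrite -adj_glue; apply: sS.
pose S1 : {set T} := [set x | inl (inl x) \in S].
pose S2 : {set U} := [set y | inl (inr y) \in S].
pose I : {set 'I_s} := [set i | inr i \in S].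
pose I1 := [set i in I | v i \notin S1]; pose I2 := [set i in I | v i \in S1].
have -> : #|S| = (#|S1| + #|I1|) + (#|S2| + #|I2|).
  have -> : #|S| = #|S1| + #|S2| + #|I|.
    rewrite card_sum_set card_sum_set; congr (_ + _ + _); apply: eq_card => x;
      by rewrite !inE.
  have -> : #|I| = #|I2| + #|I1|.
    rewrite -(cardsID [set i | v i \in S1] I); congr (_ + _);
      by apply: eq_card => i; rewrite !inE // andbC.
  lia.
apply: leq_add.
- have dis : S1 :&: v @: I1 = set0.
    apply/setP => x; rewrite in_setI in_set0; apply/andP => -[xS /imsetP[i]].
    by rewrite inE => /andP[_ vi] ex; rewrite -ex xS in vi.
  rewrite -(card_imset (mem I1) injv) -cardsUI dis cards0 addn0.
  apply: stable_le_alpha; apply/stableP => x y.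
  rewrite !in_setU => /orP[xS|/imsetP[i iI ->]] /orP[yS|/imsetP[j jI ->]] //.
  + by rewrite !inE in xS yS; exact: nS xS yS.
  + move: jI; rewrite !inE in xS *; case/andP => jS _.
    by have := nS _ _ xS jS; rewrite /= adj_sym.
  + move: iI; rewrite !inE in yS *; case/andP => iS _.
    by have := nS _ _ yS iS.
- have uS i : i \in I2 -> u i \notin S2.
    rewrite !inE => /andP[iS _]; apply/negP => uiS.
    by have := nS _ _ uiS iS; rewrite /= eqxx.
  have dis : S2 :&: u @: I2 = set0.
    apply/setP => x; rewrite in_setI in_set0;
      apply/andP => -[xS /imsetP[i iI ex]].
    by have := uS _ iI; rewrite -ex xS.
  have cr i y : i \in I2 -> y \in S2 -> ~~ adj H (u i) y.
    rewrite !inE => /andP[_ viS] yS; apply/negP => auy.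
    have := nS _ _ viS yS; rewrite /= => /existsP; apply.
    by exists i; rewrite eqxx.
  rewrite -(card_imset (mem I2) inju) -cardsUI dis cards0 addn0.
  apply: stable_le_alpha; apply/stableP => x y.
  rewrite !in_setU => /orP[xS|/imsetP[i iI ->]] /orP[yS|/imsetP[j jI ->]] //.
  + by rewrite !inE in xS yS; exact: nS xS yS.
  + by rewrite adj_sym; apply: cr.
  + exact: cr.
Qed.

End Gluing.

Lemma ramsey_graph_glue n1 a1 n2 a2 :
  a1 <= n1 -> a2 <= n2 -> ramsey_graph n1 a1 -> ramsey_graph n2 a2 ->
  ramsey_graph (n1 + n2 + minn a1 a2) (a1 + a2).
Proof.
(* Stability numbers exactly [a1] and [a2] provide stable sets large enough to index [minn a1 a2]
   new vertices. *)
move=> le1 le2 /(ramsey_graph_exact le1)[T [G [tG cG aG]]].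
move=> /(ramsey_graph_exact le2)[U [H [tH cH aH]]].
have [S /stableP sS cS] := alpha_attained G.
have [R /stableP sR cR] := alpha_attained H.
have [|v injv vS] := @exists_injection T S (minn a1 a2).
  by rewrite cS aG geq_minl.
have [|u inju uR] := @exists_injection U R (minn a1 a2).
  by rewrite cR aH geq_minr.
have sv i j : ~~ adj G (v i) (v j) by apply: sS.
have su i j : ~~ adj H (u i) (u j) by apply: sR.
exists ((T + U) + 'I_(minn a1 a2))%type, (glue G H v u); split.
- exact: glue_triangle_free.
- by rewrite !card_sum card_ord cG cH.
- by apply: leq_trans (alpha_glue injv inju sv su) _; rewrite aG aH.
Qed.

(** * Properties of the triangle-free gap, and a quadratic Ramsey bound *)

Lemma gap_max2_ramsey n a : ramsey_graph n a -> uphalf n - a <= gap_max2 n.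
Proof.
move=> [T [G [tG cT aG]]].
apply: leq_trans (gap_le_gap_max2 tG (eq_leq cT)).
have := card_le_theta2 tG; rewrite cT /gap; lia.
Qed.

Lemma gap_max2_attained n :
  exists2 G : sgraph 'I_n, triangle_free G & gap G = gap_max2 n.
Proof.
have [|G tG eG] := @eq_bigmax_cond _ (@triangle_free 'I_n) (@gap _).
  by apply/card_gt0P; exists (edgeless _); apply: edgeless_triangle_free.
by exists G.
Qed.

Lemma gap_max2_mono m n : m <= n -> gap_max2 m <= gap_max2 n.
Proof.
by move=> lemn; have [G tG <-] := gap_max2_attained m;
   apply: gap_le_gap_max2; rewrite ?card_ord.
Qed.

Lemma gap_max2_add m n : gap_max2 m + gap_max2 n <= gap_max2 (m + n).
Proof.
have [G tG <-] := gap_max2_attained m; have [H tH <-] := gap_max2_attained n.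
apply: leq_trans (gap_dunion _ _) _; apply: gap_le_gap_max2.
  exact: dunion_triangle_free.
by rewrite card_sum !card_ord.
Qed.

(** Induction on [a]: the neighbours of a vertex [x] form a stable set, and any stable set of
    non-neighbours can be enlarged by [x]. This sums 2 + 3 + ... + (a + 1). *)
Lemma card_le_ramsey (T : finType) (G : sgraph T) (a : nat) (X : {set T}) :
  triangle_free G ->
  (forall S : {set T}, S \subset X -> stable G S -> #|S| <= a) ->
  #|X|.*2 <= a * (a + 3).
Proof.
move=> /triangle_freeP tG; elim: a X => [|a IH] X hX.
  have [->|[x xX]] := set_0Vmem X; first by rewrite cards0.
  have := hX [set x]; rewrite sub1set xX cards1 => /(_ isT) h.
  by have /h : stable G [set x] by apply/stableP => y z /set1P-> /set1P->;
    rewrite adj_irr.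
have [->|[x xX]] := set_0Vmem X; first by rewrite cards0.
pose N := [set y in X | adj G x y]; pose Y := [set y in X | (y != x) && ~~
  adj G x y].
have cX : #|X| <= #|N| + 1 + #|Y|.
  rewrite -(cards1 x) (leq_trans _ (leq_add (leq_card_setU _ _) (leqnn _))) //.
  rewrite (leq_trans _ (leq_card_setU _ _)) //;
    apply/subset_leq_card/subsetP => y yX.
  by rewrite !inE yX /=; case: eqP; rewrite ?orbT //=; case: adj.
have cN : #|N| <= a.+1.
  apply: hX; first by apply/subsetP => y; rewrite inE => /andP[].
  apply/stableP => y z; rewrite !inE => /andP[_ xy] /andP[_ xz].
  by apply/negP => yz; have := tG _ _ _ xy yz; rewrite xz.
have := IH Y; suff h (S : {set T}) : S \subset Y -> stable G S -> #|S| <= a.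
  by move=> /(_ h); lia.
move=> /subsetP sSY /stableP sS.
have xS : x \notin S by apply/negP => /sSY; rewrite !inE eqxx andbF.
have nx y : y \in S -> ~~ adj G x y by move/sSY; rewrite !inE => /and3P[].
have := hX (x |: S); rewrite cardsU1 xS ltnS; apply.
  apply/subsetP => y; rewrite !inE => /orP[/eqP->//|/sSY].
  by rewrite inE => /andP[].
apply/stableP => y z; rewrite !inE => /orP[/eqP->|yS] /orP[/eqP->|zS].
- by rewrite adj_irr.
- exact: nx.
- by rewrite adj_sym nx.
- exact: sS.
Qed.

(** * Circulant graphs *)

(* A circulant graph is given by the list [c] whose entry of index [d.-1] says
   whether the difference [d] is a connection; a set of vertices is a list of
   booleans. In such a list the neighbours of the first vertex are read off
   by superposing [c] on the tail, whatever this first vertex is. *)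
Section CirculantSearch.

Variable c : seq bool.

Fixpoint avoids (s c : seq bool) : bool :=
  match s, c with
  | x :: s', y :: c' => ~~ (x && y) && avoids s' c'
  | _, _ => true
  end.

Fixpoint independent (s : seq bool) : bool :=
  if s is x :: s' then (x ==> avoids s' c) && independent s' else true.

Fixpoint subtract (s c : seq bool) : seq bool :=
  match s, c with
  | x :: s', y :: c' => (x && ~~ y) :: subtract s' c'
  | _, _ => s
  end.

Fixpoint remove_first (s c : seq bool) : seq bool :=
  match s, c with
  | x :: s', y :: c' => if x && y then false :: s' else x :: remove_first s' c'
  | _, _ => s
  end.

(** Greedy pairing of each vertex with its first remaining neighbour. An independent set has at most
    one vertex in each pair, so [false] certifies that it has fewer than [k] elements; running out
    of fuel answers [true], which prunes nothing. *)
Fixpoint matching_bound (fuel : nat) (s : seq bool) (k : nat) : bool :=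
  if fuel is f.+1 then
    if k is k'.+1 then
      match s with
      | [::] => false
      | false :: s' => matching_bound f s' k
      | true :: s' => matching_bound f (remove_first s' c) k'
      end
    else true
  else true.

(** Branch and bound on whether the first vertex is taken, pruned by [matching_bound]. Only [true]
    is a certificate, so running out of fuel answers [false]. *)
Fixpoint no_independent (fuel : nat) (s : seq bool) (k : nat) : bool :=
  if fuel is f.+1 then
    if k is k'.+1 then
      match s with
      | [::] => true
      | false :: s' => no_independent f s' k
      | true :: s' =>
          if matching_bound f s k then
            if no_independent f (subtract s' c) k' then no_independent f s' k
            else false
          else true
      end
    else false
  else false.

Fixpoint included (r s : seq bool) : bool :=
  match r, s with
  | x :: r', y :: s' => (x ==> y) && included r' s'
  | [::], _ => true
  | _, [::] => false
  end.

Lemma avoids_included r s d : included r s -> avoids s d -> avoids r d.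
Proof.
elim: r s d => [|x r IH] [|y s] [|z d] //= /andP[xy rs] /andP[yz sd].
rewrite (IH s) // andbT; apply: contra yz => /andP[hx ->].
by rewrite (implyP xy).
Qed.

Lemma independent_included r s :
  included r s -> independent s -> independent r.
Proof.
elim: r s => [|x r IH] [|y s] //= /andP[xy rs] /andP[ys si].
rewrite (IH s) // andbT; apply/implyP => /(implyP xy)/(implyP ys).
exact: avoids_included.
Qed.

Lemma included_subtract r s d :
  included r s -> avoids r d -> included r (subtract s d).
Proof.
elim: r s d => [|x r IH] [|y s] [|z d] //= /andP[xy rs] /andP[yz sd].
by rewrite IH // andbT; move: xy yz; case: x; case: y; case: z.
Qed.

Lemma included_remove_first r s d :
  included r s -> avoids r d -> included r (remove_first s d).
Proof.
elim: r s d => [|x r IH] [|y s] [|z d] //= /andP[xy rs] /andP[yz sd].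
by case: ifP => /= yzE; rewrite ?rs ?IH ?xy // ?andbT; move: xy yz yzE;
  case: x; case: y; case: z.
Qed.

(** For the pairs whose first vertex is not in [r]: dropping the partner from [r] costs at most one
    element. *)
Lemma remove_first_count r s d : included r s ->
  exists r', [/\ included r' r, included r' (remove_first s d)
    & count id r <= (count id r').+1].
Proof.
have refl t : included t t by elim: t => //= x t ->; rewrite implybb.
elim: r s d => [|x r IH] [|y s] d //=; first by exists [::].
  by exists [::].
case/andP => xy rs; case: d => [|z d].
  by exists (x :: r); rewrite /= xy rs refl implybb.
case: ifP => yz.
  by exists (false :: r); rewrite /= rs refl; split=> //; case: (x);
    rewrite ?add0n.
have [r' [r'r r's cr]] := IH s d rs.
by exists (x :: r'); rewrite /= implybb r'r xy r's; split=> //; lia.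
Qed.

Lemma matching_boundP f s k r : ~~ matching_bound f s k ->
  included r s -> independent r -> count id r < k.
Proof.
elim: f s k r => // f IH [|b s] [|k] r //=; first by case: r.
case: r => [|x r] //; case: b => /= nb; last first.
  by case: x => //= rs ri; apply: IH rs ri.
move=> /= /andP[_ rs] /andP[xr ri]; case: x xr => /= [xr|_].
  by rewrite ltnS; apply: IH nb _ ri; apply: included_remove_first.
have [r' [r'r r's cr]] := remove_first_count c rs.
by apply: leq_trans cr _; apply: IH nb r's _; apply: independent_included ri.
Qed.

Lemma no_independentP f s k r : no_independent f s k ->
  included r s -> independent r -> count id r < k.
Proof.
elim: f s k r => // f IH [|b s] [|k] r //=; first by case: r.
case: b; last by case: r => [|[] r] //= h rs ri; apply: IH h rs ri.
case: ifP => [_|/negbT nb _]; last exact: matching_boundP nb.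
case: ifP => // h1 h2; case: r => [|[] r] //=; last exact: IH h2.
by move=> rs /andP[ra ri]; rewrite ltnS; apply: IH h1 _ ri;
  apply: included_subtract.
Qed.

Lemma avoidsP s d :
  reflect (forall i, nth false s i -> ~~ nth false d i) (avoids s d).
Proof.
apply: (iffP idP); elim: s d => [|x s IH] [|y d] //=.
- by move=> _ i; rewrite nth_nil.
- by move=> _ i; rewrite nth_nil.
- by move=> _ i; rewrite nth_nil.
- by case/andP => xy sd [|i] /=; [case: x xy|exact: IH].
- move=> h; rewrite IH => [|i]; last exact: (h i.+1).
  by rewrite andbT negb_and orbC -implybE; apply/implyP => hy; apply/negP => hx;
     have := h 0 hx; rewrite /= hy.
Qed.

Lemma independentP s : reflect
  (forall i d, nth false s i -> nth false s (i + d.+1) -> ~~ nth false c d)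
  (independent s).
Proof.
apply: (iffP idP); elim: s => [|x s IH] //=.
- by move=> _ i d; rewrite nth_nil.
- case/andP => /implyP xs si [|i] d /=; last exact: IH.
  by move=> /xs /avoidsP h; apply: h.
move=> h; rewrite IH => [|i d]; last exact: (h i.+1).
by rewrite andbT; apply/implyP => hx; apply/avoidsP => i; apply: (h 0 i).
Qed.

End CirculantSearch.

Section Circulant.

Variables (m : nat) (c : seq bool).
Hypotheses (sc : size c = m) (rc : rev c = c).

Definition circulant_rel : rel 'I_m.+1 :=
  fun x y => (x < y) && nth false c (y - x).-1.

Definition circulant : sgraph 'I_m.+1 := graph_of circulant_rel.

Lemma adj_circulant (x y : 'I_m.+1) :
  x < y -> adj circulant x y = nth false c (y - x).-1.
Proof.
move=> xy; rewrite adj_graph_of /circulant_rel xy (ltnNge y) (ltnW xy) /= orbF.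
by rewrite -val_eqE /= (ltn_eqF xy).
Qed.

(** [independent c c] says that no connection is the sum of two connections, whereas a triangle x <
    y < z has z - x = (y - x) + (z - y). *)
Lemma circulant_triangle_free : independent c c -> triangle_free circulant.
Proof.
move/independentP => ic; have n3 (x y z : 'I_m.+1) : x < y -> y < z ->
    adj circulant x y -> adj circulant y z -> adj circulant x z -> False.
  move=> xy yz; rewrite !adj_circulant // ?(ltn_trans xy) // => h1 h2 h3.
  have := ic (y - x).-1 (z - y).-1 h1; rewrite h2.
  have -> : (y - x).-1 + (z - y).-1.+1 = (z - x).-1 by lia.
  by move/(_ h3).
apply/triangle_freeP => x y z xy yz; apply/negP => xz.
have lt p q : adj circulant p q -> (p < q) || (q < p).
  by case: (ltngtP p q) => // /val_inj ->; rewrite adj_irr.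
have S p q : adj circulant p q = adj circulant q p := adj_sym _ p q.
have [lxy lyz lxz] := And3 (lt _ _ xy) (lt _ _ yz) (lt _ _ xz).
case/orP: lxy => l1; case/orP: lyz => l2; case/orP: lxz => l3.
- exact: (n3 x y z).
- lia.
- by apply: (n3 x z y) => //; rewrite S.
- by apply: (n3 z x y) => //; rewrite S.
- by apply: (n3 y x z) => //; rewrite S.
- by apply: (n3 y z x) => //; rewrite S.
- lia.
- by apply: (n3 z y x) => //; rewrite S.
Qed.

Lemma nth_circulant_rev d : d < m -> nth false c d = nth false c (m - d.+1).
Proof. by move=> dm; rewrite -{1}rc nth_rev sc. Qed.

(** If exactly one of the two vertices wraps around, the difference d becomes m + 1 - d, which is a
    connection along with d because [c] is a palindrome. *)
Lemma adj_circulant_rot (t x y : 'I_m.+1) :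
  adj circulant (x + t)%R (y + t)%R = adj circulant x y.
Proof.
wlog xy : x y / x < y => [W|].
  case: (ltngtP x y) => [|yx|/val_inj ->]; first exact: W.
    by rewrite adj_sym (adj_sym _ x) W.
  by rewrite !adj_irr.
have vD (p : 'I_m.+1) : (p + t)%R = (if p + t < m.+1 then p + t else p + t -
  m.+1) :> nat.
  rewrite /=; case: ltnP => h; first by rewrite modn_small.
  by rewrite -{1}(subnK h) modnDr modn_small //; have := ltn_ord p;
    have := ltn_ord t; lia.
have tm := ltn_ord t; have xm := ltn_ord x; have ym := ltn_ord y.
move: (x + t)%R (y + t)%R (vD x) (vD y) => p q {vD} /= ep eq.
case: (ltnP (x + t) m.+1) ep => hx ep; case: (ltnP (y + t) m.+1) eq => hy eq.
- rewrite !adj_circulant //; first by congr (nth _ _ _); lia.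
  by rewrite eq ep; lia.
- rewrite adj_sym !adj_circulant //; last by rewrite eq ep; lia.
  by rewrite [RHS]nth_circulant_rev; [congr (nth _ _ _)|]; lia.
- lia.
- rewrite !adj_circulant //; first by congr (nth _ _ _); lia.
  by rewrite eq ep; lia.
Qed.

(* By rotation, one may assume that vertex 0 belongs to the stable set. *)
Lemma alpha_circulant f a :
  no_independent c f (map negb c) a -> alpha circulant <= a.
Proof.
move=> hc; apply: alpha_leP => S /stableP sS.
have [->|[t tS]] := set_0Vmem S; first by rewrite cards0.
pose R : {set 'I_m.+1} := [set x | (x + t)%R \in S].
have -> : #|S| = #|R|.
  rewrite -(card_imset (mem R) (GRing.addIr t)); apply: eq_card => x.
  apply/idP/imsetP => [xS|[y]]; last by rewrite inE => yR ->.
  by exists (x - t)%R; rewrite ?inE GRing.subrK.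
have sR : {in R &, forall x y, ~~ adj circulant x y}.
  by move=> x y; rewrite !inE => xS yS; rewrite -(adj_circulant_rot t);
    apply: sS.
have R0 : ord0 \in R by rewrite inE GRing.add0r.
(* [r] describes [R] on the vertices 1 to m; vertex 0 is counted apart, and its non-neighbours are
   [map negb c]. *)
pose r := mkseq (fun i => inord i.+1 \in R) m.
have -> : #|R| = (count id r).+1.
  rewrite -sum1_card big_mkcond big_ord_recl R0 /= add1n; congr _.+1.
  rewrite -sum1_count big_map /=.
  have -> : iota 0 m = index_iota 0 m by rewrite /index_iota subn0.
  rewrite big_mkord [RHS]big_mkcond; apply: eq_bigr => i _.
  by congr (if _ \in R then _ else _); apply: val_inj; rewrite /= inordK ?ltnS.
have nr i : nth false r i -> (i < m) && (inord i.+1 \in R).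
  case: (ltnP i m) => im; first by rewrite nth_mkseq.
  by rewrite nth_default // size_mkseq.
apply: no_independentP hc _ _.
  have inc (p q : seq bool) : size p = size q ->
      (forall i, nth false p i -> nth false q i) -> included p q.
    elim: p q => [|x p IH] [|y q] //= [spq] h.
    rewrite IH // => [|i]; last exact: (h i.+1).
    by rewrite andbT; apply/implyP; apply: (h 0).
  apply: inc; first by rewrite size_mkseq size_map sc.
  move=> i /nr /andP[im iR]; rewrite (nth_map false) ?sc //.
  by have := sR _ _ R0 iR; rewrite adj_circulant inordK ?ltnS.
apply/independentP => i d /nr /andP[im iR] /nr /andP[jm jR].
have := sR _ _ iR jR; rewrite adj_circulant !inordK ?ltnS //; last by lia.
by congr (~~ nth _ _ _); lia.
Qed.

End Circulant.

(** The connections are the elements of [D] and their negatives modulo [n]. *)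
Definition circulant_list (n : nat) (D : seq nat) : seq bool :=
  mkseq (fun d => (d.+1 \in D) || (n.-1 - d \in D)) n.-1.

Lemma ramsey_graph_circulant (n a : nat) (D : seq nat) :
  let c := circulant_list n D in
  [&& 0 < n, rev c == c, independent c c & no_independent c n.+1 (map negb c)
    a] ->
  ramsey_graph n a.
Proof.
case: n => // m; rewrite /circulant_list [_.-1]/=; set c := mkseq _ _.
move=> /and4P[_ /eqP rc ic hc].
have sc : size c = m by rewrite size_mkseq.
exists 'I_m.+1, (circulant m c); split.
- exact: circulant_triangle_free.
- by rewrite card_ord.
- exact: alpha_circulant hc.
Qed.

Ltac circulant_check D :=
  apply: (@ramsey_graph_circulant _ _ D); by vm_compute.

Lemma ramsey_graph_2_1 : ramsey_graph 2 1.
Proof. circulant_check [:: 1]. Qed.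
Lemma ramsey_graph_5_2 : ramsey_graph 5 2.
Proof. circulant_check [:: 1]. Qed.
Lemma ramsey_graph_8_3 : ramsey_graph 8 3.
Proof. circulant_check [:: 1; 4]. Qed.
Lemma ramsey_graph_13_4 : ramsey_graph 13 4.
Proof. circulant_check [:: 1; 5]. Qed.
Lemma ramsey_graph_16_5 : ramsey_graph 16 5.
Proof. circulant_check [:: 1; 3; 8]. Qed.
Lemma ramsey_graph_21_6 : ramsey_graph 21 6.
Proof. circulant_check [:: 1; 3; 8]. Qed.
Lemma ramsey_graph_26_7 : ramsey_graph 26 7.
Proof. circulant_check [:: 1; 3; 8; 13]. Qed.
Lemma ramsey_graph_35_8 : ramsey_graph 35 8.
Proof. circulant_check [:: 1; 7; 11; 16]. Qed.
Lemma ramsey_graph_45_10 : ramsey_graph 45 10.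
Proof. circulant_check [:: 1; 3; 5; 12; 19]. Qed.
Lemma ramsey_graph_57_12 : ramsey_graph 57 12.
Proof. circulant_check [:: 6; 7; 10; 15; 26; 28]. Qed.
Lemma ramsey_graph_72_14 : ramsey_graph 72 14.
Proof. circulant_check [:: 2; 3; 12; 18; 22; 26; 33]. Qed.
Lemma ramsey_graph_88_16 : ramsey_graph 88 16.
Proof. circulant_check [:: 1; 4; 14; 21; 27; 30; 32; 39]. Qed.

(** * Lower bounds for triangle-free gaps *)

Definition ramsey_seeds : seq (nat * nat) :=
  [:: (0, 0); (2, 1); (5, 2); (8, 3); (13, 4); (16, 5); (21, 6); (26, 7);
      (35, 8); (45, 10); (57, 12); (72, 14); (88, 16)].

Lemma ramsey_graph_0_0 : ramsey_graph 0 0.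
Proof.
exists 'I_0, (edgeless _); rewrite edgeless_triangle_free card_ord; split=> //.
by rewrite alpha_edgeless card_ord.
Qed.

Lemma ramsey_seedsP p : p \in ramsey_seeds -> ramsey_graph p.1 p.2.
Proof.
rewrite !inE.
case/predU1P => [->|]; first exact: ramsey_graph_0_0.
case/predU1P => [->|]; first exact: ramsey_graph_2_1.
case/predU1P => [->|]; first exact: ramsey_graph_5_2.
case/predU1P => [->|]; first exact: ramsey_graph_8_3.
case/predU1P => [->|]; first exact: ramsey_graph_13_4.
case/predU1P => [->|]; first exact: ramsey_graph_16_5.
case/predU1P => [->|]; first exact: ramsey_graph_21_6.
case/predU1P => [->|]; first exact: ramsey_graph_26_7.
case/predU1P => [->|]; first exact: ramsey_graph_35_8.
case/predU1P => [->|]; first exact: ramsey_graph_45_10.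
case/predU1P => [->|]; first exact: ramsey_graph_57_12.
case/predU1P => [->|]; first exact: ramsey_graph_72_14.
by move/eqP ->; exact: ramsey_graph_88_16.
Qed.

(* The entry of index [a] is the largest order, for stability number at most
   [a], obtained from the seeds by gluing. *)
Definition ramsey_table : seq nat :=
  [:: 0; 2; 5; 8; 13; 16; 21; 26; 35; 38; 45; 48; 57; 60; 72; 75; 88; 91; 95;
      99; 105; 109; 115; 121; 131; 135; 143; 147; 158; 161; 174; 178; 192; 195;
      199; 203; 209].

Lemma ramsey_tableP a :
  a < 37 -> a <= nth 0 ramsey_table a /\ ramsey_graph (nth 0 ramsey_table a) a.
Proof.
pose t := nth 0 ramsey_table.
(* Each entry is a seed or is reached by gluing two earlier entries; [a <= t a] is what gluing
   requires. *)
have tE : all (fun a => (a <= t a) && (((t a, a) \in ramsey_seeds) ||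
    has (fun b => (0 < b < a) && (t a <= t b + t (a - b) + minn b (a - b)))
        (iota 0 a))) (iota 0 37) by vm_compute.
elim/ltn_ind: a => a IH a37; have := allP tE a; rewrite mem_iota => /(_ a37).
case/andP => ta /orP[/ramsey_seedsP //|];
  case/hasP => b _ /andP[/andP[b0 ba] le].
split=> //; apply: ramsey_graph_mono le _ _; first exact: leqnn.
have [lb rb] := IH b ba (ltn_trans ba a37).
have [|lab rab] := IH (a - b) _ (leq_ltn_trans (leq_subr _ _) a37); first lia.
by have := ramsey_graph_glue lb lab rb rab; rewrite subnKC // ltnW.
Qed.

(** Gluing the graph of order 72 adds 72 + 14 = 86 vertices, of which 84 are kept: half the order
    minus the stability number then grows by 42 - 14 = 28 = 84 / 3, the slope required. *)
Lemma ramsey_graph_period n a q : 14 <= a <= n -> ramsey_graph n a ->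
  ramsey_graph (n + 84 * q) (a + 14 * q).
Proof.
move=> /andP[a14 an] rn; elim: q => [|q IH]; first by rewrite !muln0 !addn0.
have := @ramsey_graph_glue _ _ 72 14 _ isT IH ramsey_graph_72_14.
rewrite mulnS => /(_ ltac:(lia)); apply: ramsey_graph_mono; lia.
Qed.

Definition table_gap (n : nat) : nat := uphalf n - find (leq n) ramsey_table.

Lemma find_ramsey_table n : n <= 209 ->
  find (leq n) ramsey_table <= n /\ ramsey_graph n (find (leq n) ramsey_table).
Proof.
move=> n209; have h : has (leq n) ramsey_table.
  by apply/hasP; exists 209; rewrite ?inE.
have := nth_find 0 h; move: h; rewrite has_find; set a := find _ _ => a37 na.
have [_ ra] := ramsey_tableP a37; split; last exact: ramsey_graph_mono ra.
have : all (fun n => find (leq n) ramsey_table <= n) (iota 0 210) by vm_compute.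
by move/allP/(_ n); rewrite mem_iota; apply.
Qed.

Lemma table_gap_le n : n <= 209 -> table_gap n <= gap_max2 n.
Proof. by case/find_ramsey_table => _ /gap_max2_ramsey. Qed.

Lemma gap_max2_lower n : (n - 8) %/ 3 <= gap_max2 n.
Proof.
have [n123|n123] := ltnP n 123.
  (* For small orders, the disjoint union of two table graphs is enough. *)
  have : all (fun n => has (fun m => (n - 8) %/ 3 <= table_gap m + table_gap
    (n - m))
    (iota 0 n.+1)) (iota 0 123) by vm_compute.
  move/allP/(_ n); rewrite mem_iota => /(_ n123) /hasP[m].
  rewrite mem_iota add0n ltnS => /= mn; move/leq_trans; apply.
  rewrite -{2}(subnKC mn); apply: leq_trans (gap_max2_add _ _).
  by apply: leq_add; apply: table_gap_le; lia.
(* Reduction to the window from 123 to 206, where a single table graph suffices and has stability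
   parameter at least 14, so that it can be extended periodically. *)
pose q := (n - 123) %/ 84; pose m := n - 84 * q.
have nE : n = m + 84 * q by rewrite /m /q; lia.
have m_ge : 123 <= m by rewrite /m /q; lia.
have m_lt : m < 207 by rewrite /m /q; lia.
have : all (fun m => (14 <= find (leq m) ramsey_table) &&
    ((m - 8) %/ 3 + find (leq m) ramsey_table <= uphalf m)) (iota 123 84).
  by vm_compute.
move/allP/(_ m); rewrite mem_iota m_ge => /(_ m_lt) /andP[f14 fm].
have [fn rf] := find_ramsey_table (ltnW (ltn_trans m_lt (isT : 207 < 209))).
have := gap_max2_ramsey (@ramsey_graph_period _ _ q _ rf).
rewrite f14 fn -nE => /(_ isT); apply: leq_trans; lia.
Qed.

(** The [3 * k] vertices of [k] triangles are the budget. Gluing a table graph of stability number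
    at most [b] makes half the order minus the stability number grow by about [k], up to a loss of
    2. *)
Lemma ramsey_graph_extend n a k : 8 <= a <= n -> ramsey_graph n a ->
  exists e b, [/\ e <= 3 * k, k + b <= e./2 + 2 & ramsey_graph (n + e) (a + b)].
Proof.
move=> /andP[a8 an] rn; pose t := nth 0 ramsey_table.
have ext b : b < 37 -> ramsey_graph (n + (t b + minn 8 b)) (a + b).
  move=> /ramsey_tableP[tb rb]; have := ramsey_graph_glue an tb rn rb.
  by apply: ramsey_graph_mono => //; rewrite -addnA !leq_add2l; lia.
pose ok k b := k + b <= (minn (3 * k) (t b + minn 8 b))./2 + 2.
have [k8|k8] := ltnP k 8.
  have : all (fun k => has (ok k) (iota 0 37)) (iota 0 8) by vm_compute.
  move/allP/(_ k); rewrite mem_iota => /(_ k8) /hasP[b].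
  rewrite mem_iota => b37 kb; exists (minn (3 * k) (t b + minn 8 b)), b.
  split=> //; first exact: geq_minl.
  by apply: ramsey_graph_mono (ext b b37) => //; rewrite leq_add2l geq_minr.
pose q := (k - 8) %/ 28; pose j := k - 28 * q.
have kE : k = j + 28 * q by rewrite /j /q; lia.
have j_ge : 8 <= j by rewrite /j /q; lia.
have j_lt : j < 36 by rewrite /j /q; lia.
(* [b] starts at 6 so that [a + b] reaches the 14 needed for periodic extension. *)
have : all (fun k => has (ok k) (iota 6 31)) (iota 8 28) by vm_compute.
move/allP/(_ j); rewrite mem_iota j_ge => /(_ j_lt) /hasP[b].
rewrite mem_iota => /andP[b6 b37] jb.
exists (minn (3 * j) (t b + minn 8 b) + 84 * q), (b + 14 * q); split.
- by rewrite kE; have := geq_minl (3 * j) (t b + minn 8 b); lia.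
- by move: jb; rewrite /ok kE; lia.
have := @ramsey_graph_period _ _ q _ (ext b b37).
have [tb _] := ramsey_tableP b37; rewrite -/(t b) in tb.
move=> /(_ ltac:(lia)); apply: ramsey_graph_mono; last by rewrite addnA.
by have := geq_minr (3 * j) (t b + minn 8 b); lia.
Qed.

Lemma gap_max2_extend n a k : 8 <= a <= n -> ramsey_graph n a ->
  uphalf n + k <= gap_max2 (n + 3 * k) + a + 2.
Proof.
move=> ha rn; have [e [b [ek kb re]]] := ramsey_graph_extend k ha rn.
have := gap_max2_ramsey re; have := @gap_max2_mono (n + e) (n + 3 * k).
rewrite leq_add2l => /(_ ek); lia.
Qed.

(** * Factor-critical classes *)

Section Matching.

Variables (T : finType) (G : sgraph T).
Implicit Types f g : {ffun T -> T}.

(* A matching is an involution moving each vertex to itself or to a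
   neighbour; its fixed points are the unmatched vertices. *)
Definition matching f : bool :=
  [forall x, (f (f x) == x) && ((f x == x) || adj G x (f x))].

Definition defect f : nat := #|[set x | f x == x]|.

Lemma matchingP f : reflect
  (forall x, f (f x) = x /\ (f x = x \/ adj G x (f x))) (matching f).
Proof.
apply: (iffP forallP) => h x.
  by have /andP[/eqP ? /orP[/eqP|]] := h x; split=> //; [left|right].
by have [-> [->|->]] := h x; rewrite !eqxx ?orbT.
Qed.

Lemma card_add_defect f : #|T| + defect f = \sum_x (1 + (f x == x)).
Proof.
rewrite big_split /= sum1_card; congr (_ + _).
rewrite /defect -sum1_card big_mkcond; apply: eq_bigr => x _.
by rewrite inE; case: eqP.
Qed.

(** The edges and the fixed points of [f] form a clique partition, and each part contributes 2 to
    the sum of [1 + (f x == x)]. *)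
Lemma theta_le_matching f : matching f -> (theta G).*2 <= #|T| + defect f.
Proof.
move/matchingP => mf; pose F x := [set x; f x].
have FG : clique_coloring G F.
  move=> x y Fxy nxy; have : y \in F x by rewrite Fxy !inE eqxx.
  rewrite !inE eq_sym (negbTE nxy) /= => /eqP ey; rewrite ey.
  by have [_ [fx|//]] := mf x; move: nxy; rewrite ey fx eqxx.
rewrite card_add_defect (partition_big F (mem (F @: [set: T]))) => [|x _];
  last exact: imset_f.
apply: leq_trans (_ : \sum_(K in F @: [set: T]) 2 <= _).
  by rewrite sum_nat_const muln2 leq_double; apply: theta_le_imset.
apply: leq_sum => _ /imsetP[x _ ->]; rewrite (bigD1 x) ?eqxx //=.
have [//|nfx] := eqVneq (f x) x; rewrite (bigD1 (f x)) /=; first lia.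
by rewrite nfx andbT /F (mf x).1 setUC.
Qed.

(** Colour classes have at most two vertices, and exchanging them gives a matching. With
    [theta_le_matching], twice [theta] is the order plus the least defect. *)
Lemma exists_matching_theta : triangle_free G ->
  exists2 f, matching f & #|T| + defect f <= (theta G).*2.
Proof.
move/triangle_freeP => tG; have [C [g [cC gG]]] := theta_coloring G.
have g3 x y z : x != y -> y != z -> x != z -> g x = g y -> g y = g z -> False.
  move=> xy yz xz gxy gyz; have := tG x y z (gG _ _ gxy xy) (gG _ _ gyz yz).
  by rewrite gG // gxy.
pose f := [ffun x => odflt x [pick y | (y != x) && (g y == g x)]].
have fP x : (f x = x /\ forall y, g y = g x -> y = x) \/ (f x != x /\ g (f x)
  = g x).
  rewrite ffunE; case: pickP => [y /andP[yx /eqP gyx]|h] /=; [by right|left].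
  split=> // y gyx; apply/eqP/negPn/negP => nyx.
  by have := h y; rewrite nyx gyx eqxx.
exists f.
  apply/matchingP => x; case: (fP x) => [[fx _]|[nfx gfx]];
    first by rewrite !fx; split; [|left].
  split; last by right; apply: gG; rewrite ?gfx // eq_sym.
  case: (fP (f x)) => [[_ /(_ x)] h|[nffx gffx]].
    by move: nfx; rewrite -(h (esym gfx)) eqxx.
  apply/eqP/negPn/negP => nx.
  by apply: (g3 (f (f x)) (f x) x) => //; rewrite gffx.
rewrite card_add_defect (partition_big g predT) //= -cC -muln2
  -sum_nat_const; apply: leq_sum => c _.
case: (pickP (fun x => g x == c)) => [x /eqP gx|h]; last by rewrite big_pred0.
rewrite (bigD1 x) ?gx //=; case: (fP x) => [[fx hx]|[nfx gfx]].
  rewrite fx eqxx big_pred0 // => y; apply/andP => -[/eqP gy].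
  by rewrite (hx y) ?eqxx // gy.
rewrite (negbTE nfx) (bigD1 (f x)) /= ?gfx ?gx ?eqxx //.
rewrite big_pred0 => [|y]; last first.
  apply/negP => /andP[/andP[/eqP gy nyx] nyf].
  by apply: (g3 y (f x) x) => //; rewrite ?gy ?gfx ?gx.
rewrite addn0; case: eqP => // ff.
case: (fP (f x)) => [[_ /(_ x)] h|[nff _]]; last by rewrite ff eqxx in nff.
by move: nfx; rewrite -(h (esym gfx)) eqxx.
Qed.

Definition max_matching f : bool :=
  matching f && [forall g, matching g ==> (defect f <= defect g)].

Lemma max_matchingP f : reflect
  (matching f /\ forall g, matching g -> defect f <= defect g) (max_matching f).
Proof.
apply: (iffP andP) => -[mf h]; split=> //.
  by move=> g; move/forallP: h => /(_ g)/implyP.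
by apply/forallP => g; apply/implyP; apply: h.
Qed.

(* Match the free vertex [x] to [y], releasing the former partner of [y]. *)
Definition rematch f x y : {ffun T -> T} :=
  [ffun w => if w == x then y else if w == y then x
             else if w == f y then w else f w].

Section Rematch.

Variables (f : {ffun T -> T}) (x y : T).
Hypotheses (mf : matching f) (fx : f x = x) (xy : adj G x y).

Let nxy : x != y.
Proof. by apply/eqP => exy; move: xy; rewrite exy adj_irr. Qed.

Lemma rematch_matching : matching (rematch f x y).
Proof.
apply/matchingP => w; rewrite !ffunE.
have [ff aw] := matchingP _ mf w; have [ffy _] := matchingP _ mf y.
have [wx|wx] := eqVneq w x; first by rewrite wx eq_sym (negbTE nxy) eqxx;
  split=> //; right.
have [wy|wy] := eqVneq w y; first by rewrite wy eqxx; split=> //; right;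
  rewrite adj_sym.
have [wfy|wfy] := eqVneq w (f y).
  by rewrite (negbTE wx) (negbTE wy) wfy eqxx; split=> //; left.
have -> : (f w == x) = false.
  by apply/eqP => fw; move: wx; rewrite -ff fw fx eqxx.
have -> : (f w == y) = false.
  by apply/eqP => fw; move: wfy; rewrite -fw ff eqxx.
have -> : (f w == f y) = false.
  by apply/eqP => fw; move: wy; rewrite -ff fw ffy eqxx.
by [].
Qed.

Lemma rematch_defect : defect (rematch f x y) <= defect f.
Proof.
rewrite /defect (cardsD1 x [set z | f z == z]) inE fx eqxx add1n.
apply: (@leq_trans #|f y |: ([set z | f z == z] :\ x)|).
  apply/subset_leq_card/subsetP => w; rewrite !inE ffunE.
  case: (w =P x) => [->|_]; first by rewrite eq_sym (negbTE nxy).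
  case: (w =P y) => [->|_]; first by rewrite (negbTE nxy).
  by case: (w =P f y).
by rewrite cardsU1; case: (_ \notin _).
Qed.

Lemma rematch_defect_lt : f y = y -> defect (rematch f x y) < defect f.
Proof.
move=> fy; rewrite /defect (cardsD1 x [set z | f z == z]) inE fx eqxx add1n
  ltnS.
apply/subset_leq_card/subsetP => w; rewrite !inE ffunE.
case: (w =P x) => [->|_]; first by rewrite eq_sym (negbTE nxy).
case: (w =P y) => [->|wy]; first by rewrite (negbTE nxy).
by rewrite fy; case: (w =P y).
Qed.

End Rematch.

(** Distinct vertices are tied when no maximum matching misses both. If every vertex is missed by
    some maximum matching, this is an equivalence whose classes are closed under adjacency. *)
Definition tied u v : bool :=
  (u == v) || ~~ [exists f, [&& max_matching f, f u == u & f v == v]].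

Lemma tiedP u v : tied u v -> forall f, max_matching f -> f u = u -> f v = v
  -> u = v.
Proof.
case/orP => [/eqP//|/existsP h] f mf fu fv; case: h; exists f.
by rewrite mf fu fv !eqxx.
Qed.

Lemma not_tied u v : ~~ tied u v ->
  u != v /\ exists f, [/\ max_matching f, f u = u & f v = v].
Proof.
rewrite negb_or negbK => /andP[-> /existsP[f /and3P[mf /eqP fu /eqP fv]]].
by split=> //; exists f.
Qed.

Lemma tied_sym u v : tied u v = tied v u.
Proof.
rewrite /tied eq_sym; congr (_ || ~~ _); apply: eq_existsb => f.
by congr andb; rewrite andbC.
Qed.

Lemma adj_tied u v : adj G u v -> tied u v.
Proof.
move=> uv; apply/negPn/negP => /not_tied[_ [f [/max_matchingP[mf hf] fu fv]]].
have := hf _ (rematch_matching mf fu uv).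
by rewrite leqNgt (rematch_defect_lt fu uv fv).
Qed.

(* Gallai's argument: if M misses u and v, compare it with a maximum
   matching N missing t that agrees with M as much as possible. *)
Lemma tied_trans u t v :
  (exists2 f, max_matching f & f t = t) -> tied u t -> tied t v -> tied u v.
Proof.
move=> [N0 mN0 N0t] ut tv; apply/negPn/negP => /not_tied[nuv [M [mM Mu Mv]]].
pose agree f := #|[set w | f w == M w]|.
have [N /andP[mN /eqP Nt] Nmax] :
    exists2 N, max_matching N && (N t == t)
      & forall f, max_matching f -> f t = t -> agree f <= agree N.
  pose P f := max_matching f && (f t == t).
  have P0 : P N0 by rewrite /P mN0 N0t eqxx.
  case: (arg_maxnP agree P0) => N PN Nmax; exists N => // f mf ft.
  by apply: Nmax; rewrite /P mf ft eqxx.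
have ntu : t != u.
  by apply/eqP => tu; rewrite tu in tv; move: nuv;
    rewrite (tiedP tv mM Mu Mv) eqxx.
have ntv : t != v.
  by apply/eqP => tv'; rewrite tv' in ut; move: nuv;
    rewrite (tiedP ut mM Mu Mv) eqxx.
have Mt : M t != t by apply: contra ntu => /eqP Mt; rewrite (tiedP ut mM Mu Mt).
have Nu : N u != u by apply: contra ntu => /eqP Nu; rewrite (tiedP ut mN Nu Nt).
have Nv : N v != v by apply: contra ntv => /eqP Nv; rewrite (tiedP tv mN Nt Nv).
have [maM leM] := max_matchingP _ mM; have [maN leN] := max_matchingP _ mN.
pose FM := [set w | M w == w]; pose FN := [set w | N w == w].
(* Both matchings are maximum, so as many vertices are free in [N] only as in [M] only. As [u] and
   [v] are of the latter kind, some [x] other than [t] is of the former. *)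
have cF : #|FM :\: FN| = #|FN :\: FM|.
  apply/eqP; rewrite -(eqn_add2l #|FM :&: FN|) cardsID setIC cardsID.
  by rewrite eqn_leq leM ?leN.
have c2 : 1 < #|FN :\: FM|.
  rewrite -cF; apply: leq_trans (_ : #|[set u; v]| <= _);
    first by rewrite cards2 nuv.
  by apply/subset_leq_card/subsetP => w; rewrite !inE => /orP[]/eqP ->;
     rewrite ?Mu ?Mv ?(negbTE Nu) ?(negbTE Nv) eqxx.
have [x] : exists x, x \in (FN :\: FM) :\ t.
  apply/card_gt0P; move: c2; rewrite (cardsD1 t); case: (t \in _) => //.
  exact: ltnW.
rewrite !inE => /and3P[nxt Mx /eqP Nx].
have [MMx [|axy]] := matchingP _ maM x; first by move/eqP; rewrite (negbTE Mx).
set y := M x in MMx axy Mx.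
have Ny : N y != y.
  apply/eqP => Ny; have := leN _ (rematch_matching maN Nx axy).
  by rewrite leqNgt (rematch_defect_lt Nx axy Ny).
have [NNy _] := matchingP _ maN y.
(* Putting the edge [xy] of [M] into [N] keeps [t] free and the matching maximum, but makes it agree
   with [M] at [x] as well, against the choice of [N]. *)
have mN' : max_matching (rematch N x y).
  apply/max_matchingP; split; first exact: rematch_matching.
  by move=> g /leN; apply: leq_trans; apply: rematch_defect.
have nty : t != y by apply: contra Ny => /eqP <-; rewrite Nt.
have N't : rematch N x y t = t.
  by rewrite ffunE eq_sym (negbTE nxt) (negbTE nty) Nt if_same.
have Nyx : N y != x.
  by apply/eqP => Nyx; move: Mx; rewrite -[y]NNy Nyx Nx eqxx.
have := Nmax _ mN' N't; rewrite leqNgt /agree => /negP; apply.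
apply: proper_card; apply/properP; split.
  apply/subsetP => w; rewrite !inE => /eqP Nw; rewrite ffunE.
  have [wx|_] := eqVneq w x; first by rewrite wx.
  have [wy|_] := eqVneq w y; first by rewrite wy MMx.
  have [wz|_] := eqVneq w (N y); last by rewrite Nw.
  have [MMw _] := matchingP _ maM w.
  by move: Nyx; rewrite -wz -MMw -Nw wz NNy MMx eqxx.
by exists x; rewrite !inE ?ffunE ?eqxx // Nx eq_sym.
Qed.

End Matching.

(** [C] is the class of vertices tied to [x]. A maximum matching preserves [C] and misses at most
    one of its vertices, and [theta_le_matching] then applies within [C]. *)
Lemma gallai_class (T : finType) (G : sgraph T) (x : T) :
  triangle_free G ->
  (forall v, theta (restrict G (~: [set v])) < theta G) ->
  exists C : {set T}, [/\ x \in C,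
    forall y z, y \in C -> adj G y z -> z \in C
    & (theta (restrict G C)).*2 <= #|C|.+1].
Proof.
move=> tG crit.
(* An optimal matching of the graph without [v], extended by leaving [v] free, is maximum because
   [theta] drops when [v] is deleted. *)
have miss v : exists2 f, max_matching G f & f v = v.
  have := exists_matching_theta (restrict_triangle_free (~: [set v]) tG).
  case=> f /matchingP mf; rewrite card_restrict cardsC1 => df.
  pose g := [ffun w => if insub w is Some u then val (f u) else w].
  have gv (u : {w | w \in ~: [set v]}) : g (val u) = val (f u) by rewrite
    ffunE valK.
  have gvv : g v = v by rewrite ffunE insubF // !inE eqxx.
  have wP w : w = v \/ exists u : {w | w \in ~: [set v]}, w = val u.
    have [->|nwv] := eqVneq w v; [by left|right].
    have wv : w \in ~: [set v] by rewrite !inE.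
    by exists (Sub w wv).
  exists g => //; apply/max_matchingP; split.
    apply/matchingP => w; case: (wP w) => [->|[u ->]]; first by rewrite !gvv;
      split; [|left].
    rewrite !gv; have [-> h] := mf u; split=> //.
    by case: h => [->|]; [left|rewrite adj_pull; right].
  have dg : defect g <= (defect f).+1.
    apply: leq_trans (_ : #|v |: val @: [set u | f u == u]| <= _).
      apply/subset_leq_card/subsetP => w; rewrite !inE.
      case: (wP w) => [->|[u ->]]; first by rewrite eqxx.
      by rewrite gv val_eqE => fu; rewrite mem_imset ?inE ?fu ?orbT //;
        apply: val_inj.
    by rewrite cardsU1 card_imset; [rewrite /defect;
      case: (_ \notin _)|exact: val_inj].
  move=> h /theta_le_matching; have := crit v.
  have : 0 < #|T| by apply/card_gt0P; exists v.
  lia.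
pose C := [set y | tied G x y].
have tr u t v : tied G u t -> tied G t v -> tied G u v by apply: tied_trans.
have cl y z : y \in C -> adj G y z -> z \in C.
  by rewrite !inE => xy /adj_tied; apply: tr.
exists C; split=> //; first by rewrite inE /tied eqxx.
have [f mf _] := miss x; have [/matchingP maf _] := max_matchingP _ _ mf.
have fC y : y \in C -> f y \in C.
  by move=> yC; have [_ [->//|]] := maf y; apply: cl.
(* The default value is never taken, by [fC]. *)
pose g := [ffun y : {y | y \in C} => insubd y (f (val y))].
have gE y : val (g y) = f (val y) by rewrite ffunE insubdK // fC // (valP y).
have mg : matching (restrict G C) g.
  apply/matchingP => y; have [ff h] := maf (val y); split.
    by apply: val_inj; rewrite !gE.
  by case: h => [fy|]; [left; apply: val_inj; rewrite gE|right;
    rewrite adj_pull gE].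
apply: leq_trans (theta_le_matching mg) _;
  rewrite card_restrict -addn1 leq_add2l.
apply/card_le1_eqP => y z; rewrite !inE => /eqP gy /eqP gz; apply: val_inj.
have yC := valP y; have zC := valP z; rewrite !inE in yC zC.
by apply: (tiedP _ mf); [apply: (tr _ x _ _ yC);
  rewrite tied_sym|rewrite -gE gz|rewrite -gE gy].
Qed.

(** * Gaps of triangle-free graphs with added triangles *)

Lemma alpha_closed (T : finType) (G : sgraph T) (C : {set T}) :
  (forall y z, y \in C -> adj G y z -> z \in C) ->
  alpha (restrict G C) + alpha (restrict G (~: C)) <= alpha G.
Proof.
move=> cl; have [S /stableP sS <-] := alpha_attained (restrict G C).
have [R /stableP sR <-] := alpha_attained (restrict G (~: C)).
rewrite -(card_imset (mem S) val_inj) -(card_imset (mem R) val_inj) -cardsUI.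
have ncl y z : y \in C -> z \notin C -> ~~ adj G y z.
  by move=> yC; apply: contra; apply: cl.
have nC (r : {x | x \in ~: C}) : val r \notin C by have := valP r; rewrite inE.
rewrite (_ : _ :&: _ = set0) ?cards0 ?addn0; last first.
  apply/setP => x; rewrite in_setI in_set0; apply/andP => -[/imsetP[s _ ->]].
  by case/imsetP => r _ sr; have := nC r; rewrite -sr (valP s).
apply: stable_le_alpha; apply/stableP => y z; rewrite !in_setU.
case/orP => /imsetP[p pS ->] /orP[]/imsetP[q qS ->].
- by have := sS _ _ pS qS; rewrite adj_pull.
- by apply: ncl; [exact: valP|exact: nC].
- by rewrite adj_sym; apply: ncl; [exact: valP|exact: nC].
- by have := sR _ _ pS qS; rewrite adj_pull.
Qed.

Lemma gap_closed (T : finType) (G : sgraph T) (C : {set T}) :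
  (forall y z, y \in C -> adj G y z -> z \in C) ->
  gap G <= gap (restrict G C) + gap (restrict G (~: C)).
Proof.
move=> /alpha_closed; have := theta_restrictC G C; rewrite /gap.
have := alpha_le_theta (restrict G C).
have := alpha_le_theta (restrict G (~: C)); lia.
Qed.

Lemma alpha_le_card (T : finType) (G : sgraph T) : alpha G <= #|T|.
Proof. by apply: alpha_leP => S _; apply: max_card. Qed.

(* A graph with gap above (n - 2) / 3 has n >= 6 alpha - 5, which the
   quadratic Ramsey bound only allows for alpha >= 8. *)
Lemma gap_replace (T : finType) (G : sgraph T) (k : nat) :
  triangle_free G -> (theta G).*2 <= #|T|.+1 -> 0 < gap G ->
  gap G + k <= gap_max2 (#|T| + 3 * k) + 2.
Proof.
move=> tG thG gG; have := gap_max2_lower (#|T| + 3 * k).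
(* In the first case the general lower bound is enough: (3 gap + 2 + 3k - 8) / 3 = gap + k - 2. *)
have [hn _|hn low] := leqP ((gap G) * 3 + 2) #|T|.
  by have := gap_max2_lower (#|T| + 3 * k); lia.
have ra : ramsey_graph #|T| (alpha G) by exists T, G.
have aT := alpha_le_card G.
have : #|[set: T]|.*2 <= alpha G * (alpha G + 3).
  by apply: card_le_ramsey tG _ => S _; apply: stable_le_alpha.
rewrite cardsT; have : gap G + alpha G <= uphalf #|T|.
  by move: gG; rewrite /gap; lia.
have [a8 ga _|a8] := leqP 8 (alpha G).
  have := @gap_max2_extend #|T| (alpha G) k; rewrite a8 aT => /(_ isT ra); lia.
(* Each value of [alpha G] below 8 contradicts the positive gap, the bound on [gap G + alpha G] or
   the quadratic bound. *)
move: (alpha G) a8 => a; do 8![case: a => [|a]; first lia]; lia.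
Qed.

Lemma gap_add_triangles (T : finType) (G : sgraph T) (k : nat) :
  triangle_free G -> 0 < gap G -> gap G + k <= gap_max2 (#|T| + 3 * k) + 2.
Proof.
have [n] := ubnP #|T|; elim: n T G => // n IH T G leTn tG gG.
have [v hv|crit] := pickP (fun v => theta G <= theta (restrict G (~: [set v]))).
  have cv : #|{: {x | x \in ~: [set v]}}|.+1 = #|T|.
    by rewrite card_restrict cardsC1 prednK //; apply/card_gt0P; exists v.
  have gv : gap G <= gap (restrict G (~: [set v])).
    by have := alpha_restrict G (~: [set v]); rewrite /gap; lia.
  have := IH _ (restrict G (~: [set v])); rewrite -ltnS cv => /(_ leTn).
  move=> /(_ (restrict_triangle_free _ tG) (leq_trans gG gv)) h.
  have mono : gap_max2 (#|{: {x | x \in ~: [set v]}}| + 3 * k) <= gap_max2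
    (#|T| + 3 * k).
    by apply: gap_max2_mono; rewrite leq_add2r -cv.
  exact: leq_trans (leq_add gv (leqnn k)) (leq_trans h (leq_add mono (leqnn
    2))).
have [x _] : exists x, x \in T.
  apply/card_gt0P; rewrite lt0n; apply: contraTneq gG => T0.
  have := theta_le_order G; rewrite /gap T0; lia.
have [|C [xC clC thC]] := gallai_class x tG.
  by move=> v; rewrite ltnNge crit.
have gC := gap_closed clC; have cC := cardsC C.
have [g0|g0] := posnP (gap (restrict G C)).
  have := IH _ (restrict G (~: C)); rewrite card_restrict.
  have C0 : 0 < #|C| by apply/card_gt0P; exists x.
  have lt : #|~: C| < n by lia.
  move=> /(_ lt (restrict_triangle_free _ tG)).
  have : gap_max2 (#|~: C| + 3 * k) <= gap_max2 (#|T| + 3 * k).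
    by apply: gap_max2_mono; rewrite leq_add2r -cC leq_addl.
  lia.
have := gap_replace k (restrict_triangle_free C tG).
rewrite card_restrict => /(_ thC g0).
have := @gap_le_gap_max2 _ (restrict G (~: C)) #|~: C|
  (restrict_triangle_free _ tG).
rewrite card_restrict => /(_ (leqnn _)).
have := gap_max2_add (#|C| + 3 * k) #|~: C|; rewrite addnAC cC; lia.
Qed.

(** * Arbitrary graphs: removal of triangles *)

Lemma peel_triangles (T : finType) (G : sgraph T) :
  exists (k : nat) (U : finType) (H : sgraph U),
    [/\ triangle_free H, #|T| = #|U| + 3 * k, theta G <= theta H + k
      & alpha H <= alpha G].
Proof.
have [n] := ubnP #|T|; elim: n T G => // n IH T G leTn.
have [tG|] := boolP (triangle_free G).
  by exists 0, T, G; rewrite tG muln0 !addn0; split.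
rewrite negb_forall => /existsP[x]; rewrite negb_forall => /existsP[y].
rewrite negb_forall => /existsP[z]; rewrite negbK => /and3P[xy yz xz].
have ne p q : adj G p q -> p != q by apply: contraTneq => ->; rewrite adj_irr.
pose K := [set x; y; z]; have cK : #|K| = 3.
  by rewrite /K setUC cardsU1 cards2 !inE (ne _ _ xy) eq_sym negb_or (ne _ _
    xz) eq_sym (ne _ _ yz).
have kK : clique G K.
  apply/cliqueP => p q; rewrite !inE -!orbA => /or3P[]/eqP -> /or3P[]/eqP ->;
    by rewrite ?eqxx // ?xy ?yz ?xz // adj_sym ?xy ?yz ?xz.
have cT := cardsC K; have := IH _ (restrict G (~: K)); rewrite card_restrict.
have lt : #|~: K| < n by lia.
case/(_ lt) => k [U [H [tH cU thH aH]]].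
exists k.+1, U, H; split=> //; first lia.
  have := theta_restrictC G K; have := theta_clique kK; lia.
exact: leq_trans aH (alpha_restrict _ _).
Qed.

Lemma theta_le1 (T : finType) (G : sgraph T) : alpha G <= 1 -> theta G <= 1.
Proof.
move=> aG; rewrite -card_unit; apply: (@theta_le_card _ _ _ (fun=> tt)) => x
  y _ nxy.
apply/negPn/negP => naxy; suff : 1 < alpha G by rewrite ltnNge aG.
have <- : #|[set x; y]| = 2 by rewrite cards2 nxy.
by apply: stable_le_alpha; apply/stableP => p q; rewrite !inE =>
  /orP[]/eqP -> /orP[]/eqP ->; rewrite ?adj_irr // adj_sym.
Qed.

Lemma gap_le_gap_max2_add2 (T : finType) (G : sgraph T) :
  gap G <= gap_max2 #|T| + 2.
Proof.
have [k [U [H [tH cU thH aH]]]] := peel_triangles G.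
have aU := alpha_le_card H.
have [g0|g0] := posnP (gap H); last first.
  have := gap_add_triangles k tH g0; rewrite -cU => h.
  by apply: leq_trans h; rewrite /gap; lia.
have thaH : theta H <= alpha H by rewrite -subn_eq0; apply/eqP.
have [/theta_le1|a2] := leqP (alpha G) 1; first by rewrite /gap; lia.
(* Here [gap G] is at most [k], and at most [k - 1] if [U] has fewer than two vertices, since then
   [alpha H < alpha G]; the lower bound covers both cases. *)
have := gap_max2_lower #|T|; rewrite {1}cU /gap; lia.
Qed.

Lemma gap_max_le n : gap_max n <= gap_max2 n + 2.
Proof.
by apply/bigmax_leqP => G _; have := gap_le_gap_max2_add2 G; rewrite card_ord.
Qed.

Lemma gap_max2_le n : gap_max2 n <= gap_max n.
Proof. by apply/bigmax_leqP => G _; apply: (bigmax_sup G). Qed.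

(** * Smallest orders for a given gap *)

Lemma smin_le_smin2 t : smin t <= smin2 t.
Proof.
rewrite /smin2; case: ex_minnP => n /existsP[G /andP[_ gG]] _.
by rewrite /smin; case: ex_minnP => m _; apply; apply/existsP; exists G.
Qed.

(* Deleting a vertex lowers the gap by at most one. *)
Lemma smin2_le (T : finType) (G : sgraph T) (t : nat) :
  triangle_free G -> t <= gap G -> smin2 t <= #|T|.
Proof.
have [n] := ubnP #|T|; elim: n T G => // n IH T G leTn tG tgG.
have [gt|gt] := eqVneq (gap G) t.
  rewrite /smin2; case: ex_minnP => m _; apply; apply/existsP.
  exists (pull (@enum_val _ T) G); rewrite pull_triangle_free //=.
  by rewrite (gap_iso (@enum_val_bij T) (H := G)) ?gt // => x y;
    rewrite adj_pull.
have {gt tgG} tgG : t < gap G by rewrite ltn_neqAle eq_sym gt.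
have [v _] : exists v, v \in T.
  apply/card_gt0P; rewrite lt0n; apply: contraTneq tgG => T0.
  by have := theta_le_order G; rewrite /gap T0; lia.
have cv : #|{: {x | x \in ~: [set v]}}|.+1 = #|T|.
  by rewrite card_restrict cardsC1 prednK //; apply/card_gt0P; exists v.
have := IH _ (restrict G (~: [set v])); rewrite -ltnS cv => /(_ leTn).
move=> /(_ (restrict_triangle_free _ tG)) h.
have th := theta_restrictC G [set v].
have th1 : theta (restrict G [set v]) <= 1.
  by apply: theta_clique; apply/cliqueP => x y /set1P-> /set1P->; rewrite eqxx.
have := h _; rewrite -cv => hh; apply: leqW; apply: hh.
by have := alpha_restrict G (~: [set v]); move: tgG; rewrite /gap; lia.
Qed.

Lemma smin2_le_smin t : smin2 t <= smin t + 10.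
Proof.
rewrite /smin; case: ex_minnP => n /existsP[G /eqP gG] _.
(* A 5-cycle has gap at least 3 - 2 = 1; two of them make up for the loss of 2. *)
have h5 := gap_max2_ramsey ramsey_graph_5_2.
have [K tK gK] := gap_max2_attained (n + 5 + 5).
have -> : n + 10 = #|'I_(n + 5 + 5)| by rewrite card_ord -addnA.
apply: smin2_le tK _; have := gap_le_gap_max2_add2 G; rewrite gG card_ord gK.
have := gap_max2_add (n + 5) 5; have := gap_max2_add n 5.
rewrite [uphalf 5 - 2]/= in h5; lia.
Qed.

Theorem theorem4p11 (n t : nat) :
  (0 <= (gap_max n)%:Z - (gap_max2 n)%:Z <= 2)%R /\
  (0 <= (smin2 t)%:Z - (smin t)%:Z <= 10)%R.
Proof.
have := gap_max_le n; have := gap_max2_le n.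
have := smin_le_smin2 t; have := smin2_le_smin t; lia.
Qed.
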